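(* Let $p$ be a prime, let $G$ be a finite group and let $F$ be a field of characteristic $p$. Then the following conditions are equivalent: (1) the $p$-Sylow subgroup of $G$ is cyclic; (2) $\mathrm{ed}(\mathrm{Mod}_{FG}) = 0$; (3) $\mathrm{ed}(\mathrm{Mod}_{FG}) < \infty$.
   Context: $FG$ denotes the group algebra. For a finite-dimensional associative $F$-algebra $A$ and a field extension $K/F$, $A_K := K \otimes_F A$. An intermediate field $F \subset K_0 \subset K$ is a field of definition for a finitely generated $A_K$-module $M$ if there exists a finitely generated $A_{K_0}$-module $M_0$ with $M \cong K \otimes_{K_0} M_0$ as $A_K$-modules. The essential dimension $\mathrm{ed}(M)$ of $M$ over $F$ is the minimal value of $\mathrm{trdeg}(K_0/F)$, where $K_0$ ranges over all fields of definition $F \subset K_0 \subset K$ of $M$. $\mathrm{Mod}_A$ is the functor from field extensions of $F$ to sets sending $K$ to the set of isomorphism classes of finitely generated $A_K$-modules, and $\mathrm{ed}(\mathrm{Mod}_A) := \sup \mathrm{ed}(M)$, the supremum being over all field extensions $K/F$ and all finitely generated $A_K$-modules $M$ (it may be infinite). *)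

(* Defs.v *)
From mathcomp Require Import all_boot all_order all_algebra all_fingroup.
From mathcomp Require Import all_solvable all_character.
From mathcomp Require Import -(notations) mpoly.
From mathcomp Require Import boolp classical_sets reals constructive_ereal ereal.

Set Implicit Arguments.
Unset Strict Implicit.
Unset Printing Implicit Defensive.

Import Order.TTheory GRing.Theory Num.Theory.
Local Open Scope classical_set_scope.
Local Open Scope ring_scope.

(* Transcendence degrees and essential dimensions lie in {0, 1, 2, ...} with
   +oo added. They are taken in \bar R, for which the library has suprema and
   infima; the choice of R is immaterial. A supremum of a nonempty set of such
   values is again one of them, and an infimum of a nonempty set is attained. *)

(* A field extension L/F is given by a field morphism f : F -> L;
   mmap f x q is the value at x of q, its coefficients mapped by f. *)
Definition algebraically_independent (F L : fieldType) (f : {rmorphism F -> L})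
    (n : nat) (x : 'I_n -> L) : Prop :=
  forall q : mpoly n F, mmap f x q = 0 -> q = 0.

Definition trdeg (R : realType) (F L : fieldType)
    (f : {rmorphism F -> L}) : \bar R :=
  ereal_sup [set n%:R%:E | n in
    [set n : nat | exists x : 'I_n -> L, algebraically_independent f x]].

(* An intermediate field of iota : F -> K is a field K0 with morphisms
   i : F -> K0 and j : K0 -> K whose composite is iota.

   Since K (x)_F FG = KG, a finitely generated (i.e. finite-dimensional)
   (FG)_K-module is a matrix representation of G over K of some degree n,
   possibly 0; isomorphism of modules is mx_rsim, and map_repr j rM0 affords the
   extension of scalars K (x)_K0 M0. *)
Definition field_of_definition (F K : fieldType) (iota : {rmorphism F -> K})
    (gT : finGroupType) (G : {group gT}) (n : nat)
    (rM : mx_representation K G n)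
    (K0 : fieldType) (i : {rmorphism F -> K0}) (j : {rmorphism K0 -> K}) : Prop :=
  (forall a : F, j (i a) = iota a) /\
  exists (m : nat) (rM0 : mx_representation K0 G m),
    mx_rsim rM (map_repr j rM0).

Definition ed (R : realType) (F K : fieldType)
    (iota : {rmorphism F -> K}) (gT : finGroupType) (G : {group gT}) (n : nat)
    (rM : mx_representation K G n) : \bar R :=
  ereal_inf [set d | exists (K0 : fieldType) (i : {rmorphism F -> K0})
      (j : {rmorphism K0 -> K}),
    field_of_definition iota rM i j /\ d = trdeg R i].

Definition ed_Mod (R : realType) (F : fieldType)
    (gT : finGroupType) (G : {group gT}) : \bar R :=
  ereal_sup [set d | exists (K : fieldType) (iota : {rmorphism F -> K})
      (n : nat) (rM : mx_representation K G n), d = ed R iota rM].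

(* Main.v *)
Require Import Defs.
From HB Require Import structures.
From mathcomp Require Import boolp reals constructive_ereal ereal.
From mathcomp Require Import generic_quotient.
From mathcomp Require Import all_boot all_order all_algebra all_fingroup.
From mathcomp Require Import all_solvable all_field all_character.
From mathcomp Require Import -(notations) mpoly.

(** Write KG-module for a finite-dimensional representation of G over K. Since
    trdeg takes values in {0, 1, ..., +oo}, the theorem says two things: if the
    Sylow p-subgroup P is cyclic, then every KG-module is defined over a
    subfield of K that is algebraic over F ([ed_Mod_cyclic]); if P is not
    cyclic, then ed_Mod is at least n for every n ([ed_Mod_noncyclic]).

    Suppose that P is cyclic. Over any field of characteristic p a module for
    the cyclic p-group P is a sum of Jordan blocks, whose entries are 0 and 1,
    so it is defined over a finite field ([defined_over_cyclic]). It suffices to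
    treat an indecomposable KG-module M. It is a direct summand of the module induced from its restriction to P
    ([summand_induced]), because the index of P is invertible in K. Hence M is
    a summand of K (x) N for a module N over a finite field contained in K.
    Among all such pairs of a finite subfield k of K and a kG-module N, take
    one with N of minimal degree ([finite_descent]).
    Then N is indecomposable, and E = End(N) is a finite local ring. Its
    residue ring is a finite division ring, hence by Wedderburn a finite field
    k[a] = k[X]/(f) ([residue_field_generator]). If f remains irreducible over
    K, then K (x) E is an extension of the field K[X]/(f) by a nilpotent ideal
    and has no nontrivial idempotent ([idempotent_trivial]), so that M is
    K (x) N. If f factors over K, the factors have coefficients in a finite
    subfield of K, over which N decomposes, against minimality. So M is defined
    over a finite subfield of K, and a fortiori over the algebraic closure of F
    in K.

    Suppose that P is not cyclic. Then P has two independent homomorphisms to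
    the additive group of F_p, and some a and b in P on which they take the
    values (1, 0) and (0, 1) ([noncyclic_coordinates]). Over the rational
    function field K = F(t_1, ..., t_n), let a and b act on K^n + K^n by the
    unipotent block matrices with off-diagonal block 1 and diag(t_1, ..., t_n),
    and let M be the module induced to G. The rank of (b - 1) - c (a - 1) on M,
    as a function of c in K, drops below its generic value when c = t_i, since
    the module of P is a summand of the restriction of M
    ([summand_restrict_induced]). If M is defined over K0, this pencil is
    conjugate to one with entries in K0, so t_i is a root of a nonzero minor
    with coefficients in K0: each t_i is algebraic over K0
    ([shear_parameter_algebraic]). In a polynomial equation for t_i over K0 two
    terms have the same leading monomial, so K0 contains a fraction y_i whose
    leading exponent is a positive multiple of that of t_i. The monomials in
    y_1, ..., y_n have pairwise distinct leading exponents and are thus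
    linearly independent over F, so that K0 has transcendence degree at least n
    ([algebraic_vars_independent]). *)

Set Implicit Arguments.
Unset Strict Implicit.
Unset Printing Implicit Defensive.

Import Order.TTheory GRing.Theory Num.Theory.
Local Open Scope ring_scope.

(** * Direct summands and indecomposable modules *)

Section Summands.

Variables (K : fieldType) (gT : finGroupType) (G : {group gT}).
Local Notation reprG := (mx_representation K G).

Definition intertwines n1 n2 (r1 : reprG n1) (r2 : reprG n2)
    (A : 'M[K]_(n1, n2)) : Prop :=
  {in G, forall x, r1 x *m A = A *m r2 x}.

Definition summand n d (rM : reprG n) (rN : reprG d) : Prop :=
  exists A B, [/\ A *m B = 1%:M, intertwines rM rN A & intertwines rN rM B].

Definition indecomposable n (rM : reprG n) : Prop :=
  (0 < n)%N /\
  forall f, centgmx rM f -> f *m f = f -> f = 0 \/ f = 1%:M.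

Lemma intertwinesM n1 n2 n3 (r1 : reprG n1) (r2 : reprG n2) (r3 : reprG n3)
    A B :
  intertwines r1 r2 A -> intertwines r2 r3 B -> intertwines r1 r3 (A *m B).
Proof. by move=> rA rB x Gx; rewrite mulmxA rA // -!mulmxA rB. Qed.

Lemma intertwines_cent n (rM : reprG n) f :
  intertwines rM rM f <-> centgmx rM f.
Proof.
by split=> [cf | /centgmxP cf x Gx]; [apply/centgmxP=> x Gx; rewrite cf | rewrite cf].
Qed.

Lemma rsim_mutual_inverse n d (rM : reprG n) (rN : reprG d) :
  mx_rsim rM rN ->
  exists A B, [/\ A *m B = 1%:M, B *m A = 1%:M, intertwines rM rN A
               & intertwines rN rM B].
Proof.
case=> B eq_nd; case: d / eq_nd in rN B *; rewrite row_free_unit => uB hB.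
exists B, (invmx B); split=> [|||x Gx]; rewrite ?mulmxV ?mulVmx //.
by apply: (canRL (mulKmx uB)); rewrite mulmxA -hB // mulmxK.
Qed.

Lemma eq_rsim n (r1 r2 : reprG n) : {in G, r1 =1 r2} -> mx_rsim r1 r2.
Proof.
move=> eq12; exists 1%:M => // [|x Gx]; first by rewrite row_free_unit unitmx1.
by rewrite mulmx1 mul1mx eq12.
Qed.

Lemma rsim_summand n d (rM : reprG n) (rN : reprG d) :
  mx_rsim rM rN -> summand rM rN.
Proof. by case/rsim_mutual_inverse=> A [B [AB _ rA rB]]; exists A, B. Qed.

Lemma summand_trans n1 n2 n3 (r1 : reprG n1) (r2 : reprG n2) (r3 : reprG n3) :
  summand r1 r2 -> summand r2 r3 -> summand r1 r3.
Proof.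
move=> [A [B [AB rA rB]]] [C [D [CD rC rD]]].
exists (A *m C), (D *m B); split.
- by rewrite mulmxA -(mulmxA A) CD mulmx1.
- exact: intertwinesM rA rC.
exact: intertwinesM rD rB.
Qed.

Lemma summand_leq n d (rM : reprG n) (rN : reprG d) :
  summand rM rN -> (n <= d)%N.
Proof.
case=> A [B [AB _ _]]; rewrite -(mxrank1 K n) -AB.
by apply: leq_trans (mxrankM_maxl _ _) (rank_leq_col _).
Qed.

Lemma mutual_inverse_rsim n d (rM : reprG n) (rN : reprG d) (A : 'M_(n, d)) B :
    A *m B = 1%:M -> intertwines rM rN A -> B *m A = 1%:M ->
  mx_rsim rM rN.
Proof.
move=> AB rA BA; have le_nd: (n <= d)%N.
  rewrite -(mxrank1 K n) -AB.
  by apply: leq_trans (mxrankM_maxl _ _) (rank_leq_col _).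
have le_dn: (d <= n)%N.
  rewrite -(mxrank1 K d) -BA.
  by apply: leq_trans (mxrankM_maxl _ _) (rank_leq_col _).
exists A => //; first by apply/eqP; rewrite eqn_leq le_nd.
by apply/row_freeP; exists B.
Qed.

(** The outer factors of the rank factorisations of f and g can be cancelled. *)
Lemma base_mul (n : nat) (f g : 'M[K]_n) (c : 'M[K]_(\rank f, \rank g)) :
  f *m g = col_base f *m c *m row_base g -> row_base f *m col_base g = c.
Proof.
move=> fg; apply: (row_free_inj (row_base_free g)).
apply: (row_full_inj (col_base_full f)); rewrite [RHS]mulmxA -fg.
transitivity ((col_base f *m row_base f) *m (col_base g *m row_base g)).
  by move: (row_base f) (row_base g) => R S; rewrite !mulmxA.
by rewrite !mulmx_base.
Qed.

(** The image of an idempotent endomorphism f carries the representation whose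
    matrices are those of rM in the bases of a rank factorisation of f. *)
Section IdempotentImage.

Variables (n : nat) (rM : reprG n) (f : 'M[K]_n).
Hypotheses (cGf : centgmx rM f) (ff : f *m f = f).

Lemma idem_base : row_base f *m col_base f = 1%:M.
Proof. by apply: base_mul; rewrite mulmx1 mulmx_base. Qed.

Lemma idem_row : row_base f *m f = row_base f.
Proof. by rewrite -[X in _ *m X]mulmx_base mulmxA idem_base mul1mx. Qed.

Lemma idem_col : f *m col_base f = col_base f.
Proof. by rewrite -[X in X *m _]mulmx_base -mulmxA idem_base mulmx1. Qed.

Lemma idem_mx_repr : mx_repr G (fun x => row_base f *m (rM x *m col_base f)).
Proof.
split=> [|x y Gx Gy]; first by rewrite repr_mx1 mul1mx idem_base.
rewrite -[RHS]mulmxA -(mulmxA (rM x)) (mulmxA (col_base f)) mulmx_base.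
rewrite (mulmxA f) (centgmxP cGf) // -(mulmxA _ f) idem_col.
by rewrite repr_mxM // -(mulmxA (rM x)).
Qed.

Definition idem_repr : reprG (\rank f) := MxRepresentation idem_mx_repr.

Lemma idem_rowP : intertwines idem_repr rM (row_base f).
Proof.
move=> x Gx /=; rewrite -mulmxA -(mulmxA (rM x)) mulmx_base -(centgmxP cGf) //.
by rewrite mulmxA idem_row.
Qed.

Lemma idem_colP : intertwines rM idem_repr (col_base f).
Proof.
move=> x Gx /=; rewrite (mulmxA (col_base f)) mulmx_base (mulmxA f).
by rewrite (centgmxP cGf) // -mulmxA idem_col.
Qed.

Lemma idem_summand : summand idem_repr rM.
Proof.
exists (row_base f), (col_base f).
by split; [exact: idem_base | exact: idem_rowP | exact: idem_colP].
Qed.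

End IdempotentImage.

(** If A and B exhibit M as a summand of N, the complement is the image of the
    idempotent endomorphism 1 - BA of N. *)
Lemma summand_complement n d (rM : reprG n) (rN : reprG d) :
  summand rM rN ->
  exists rC : representation K G, mx_rsim rN (dadd_grepr (Representation rM) rC).
Proof.
move=> [A [B [AB rA rB]]]; pose g := 1%:M - B *m A.
have BAA : B *m A *m (B *m A) = B *m A by rewrite mulmxA -(mulmxA B) AB mulmx1.
have cg : centgmx rN g.
  apply/centgmxP=> x Gx; rewrite mulmxBl mulmxBr mul1mx mulmx1.
  by rewrite (intertwinesM rB rA Gx).
have gg : g *m g = g.
  by rewrite mulmxBl mul1mx [in X in _ - X]mulmxBr mulmx1 BAA subrr subr0.
have Ag : A *m col_base g = 0.
  apply: (row_free_inj (row_base_free g)); rewrite /= -mulmxA mulmx_base mul0mx.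
  by rewrite mulmxBr mulmx1 mulmxA AB mul1mx subrr.
have gB : row_base g *m B = 0.
  apply: (row_full_inj (col_base_full g)); rewrite /= mulmxA mulmx_base mulmx0.
  by rewrite mulmxBl mul1mx -mulmxA AB mulmx1 subrr.
exists (Representation (idem_repr cg gg)).
apply: (@mutual_inverse_rsim _ _ _ _ (row_mx B (col_base g)) (col_mx A (row_base g))).
- by rewrite mul_row_col mulmx_base addrC subrK.
- move=> x Gx; rewrite mul_mx_row mul_row_block !mulmx0 addr0 add0r.
  by rewrite (rB x Gx) (idem_colP cg gg Gx).
by rewrite mul_col_row AB idem_base // Ag gB -scalar_mx_block.
Qed.

Lemma decomposableP n (rM : reprG n) :
    (0 < n)%N -> ~ indecomposable rM ->
  exists r1 r2 : representation K G,
    [/\ (rdegree r1 < n)%N, (rdegree r2 < n)%N & mx_rsim rM (dadd_grepr r1 r2)].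
Proof.
move=> n_gt0 decM.
have [f [cGf ff /eqP f0 /eqP f1]] : exists f : 'M[K]_n,
    [/\ centgmx rM f, f *m f = f, f <> 0 & f <> 1%:M].
  apply: contrapT => noF; apply: decM; split=> // f cGf ff.
  apply: contrapT => /not_orP[f0 f1]; apply: noF.
  by exists f.
have [rC sim] := summand_complement (idem_summand cGf ff).
have n_eq : n = (\rank f + rdegree rC)%N by case: sim.
exists (Representation (idem_repr cGf ff)), rC; split=> //.
  rewrite ltn_neqAle rank_leq_col andbT; apply: contra f1 => rf.
  have uf : f \in unitmx by rewrite -row_full_unit.
  by apply/eqP; rewrite -[LHS](mulKmx uf) ff mulVmx.
by rewrite n_eq -[X in (X < _)%N]add0n ltn_add2r lt0n mxrank_eq0.
Qed.

(** A Bezout relation u q1 + v q2 = 1 makes (u q1)(a) an idempotent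
    endomorphism, which must be 0 or 1. *)
Lemma indecomposable_coprime n (rM : reprG n.+1) (a : 'M[K]_n.+1)
    (q1 q2 : {poly K}) :
    indecomposable rM -> centgmx rM a -> coprimep q1 q2 ->
    horner_mx a (q1 * q2) = 0 ->
  horner_mx a q1 = 0 \/ horner_mx a q2 = 0.
Proof.
move=> [_ indM] ca /Bezout_eq1_coprimepP[[u v] /= uv1] q12.
have cent p : centgmx rM (horner_mx a p).
  apply/centgmxP=> x Gx; symmetry; apply: comm_mx_horner.
  by rewrite /comm_mx (centgmxP ca).
have vq2 : horner_mx a (v * q2) = 1 - horner_mx a (u * q1).
  by rewrite -[1](rmorph1 (horner_mx a)) -uv1 rmorphD /= addrC addKr.
have q0 w : horner_mx a (w * (q1 * q2)) = 0 by rewrite rmorphM /= q12 mulr0.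
have ee : horner_mx a (u * q1) *m horner_mx a (u * q1) = horner_mx a (u * q1).
  have := q0 (u * v); have -> : u * v * (q1 * q2) = u * q1 * (v * q2).
    by rewrite mulrACA.
  rewrite rmorphM /= vq2 mulrBr mulr1 => /eqP.
  by rewrite subr_eq0 => /eqP/esym.
have [e0 | e1] := indM _ (cent _) ee; [left | right].
  rewrite e0 subr0 in vq2.
  rewrite -[LHS]mulr1 -vq2 -rmorphM /=.
  have -> : q1 * (v * q2) = v * (q1 * q2) by rewrite mulrCA.
  exact: q0.
rewrite -[LHS]mul1r -[X in X * _]e1 -rmorphM /= -mulrA; exact: q0.
Qed.

(** Fitting's lemma: factor the characteristic polynomial as q X^m with q(0)
    nonzero. If q(a) = 0, the constant term of q yields an inverse of a. *)
Lemma indecomposable_fitting n (rM : reprG n.+1) (a : 'M[K]_n.+1) :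
    indecomposable rM -> centgmx rM a ->
  a \in unitmx \/ a ^+ n.+1 = 0.
Proof.
move=> indM ca.
have [/= m [q]] := multiplicity_XsubC (char_poly a) 0.
rewrite monic_neq0 ?char_poly_monic //= subr0 => q0 Dq.
have cop : coprimep q ('X ^+ m).
  by rewrite coprimep_expr // -['X]subr0 -polyC0 coprimep_XsubC.
have := Cayley_Hamilton a; rewrite Dq.
have le_mn: (m <= n.+1)%N.
  have := size_char_poly a; rewrite Dq size_mul ?expf_neq0 ?polyX_eq0 //; last first.
    by apply: contraNneq q0 => ->; rewrite root0.
  rewrite size_polyXn addnS /= => sz.
  have : (0 < size q)%N by rewrite size_poly_gt0; apply: contraNneq q0 => ->; rewrite root0.
  by move: sz; case: (size q) => //= s [<-] _; rewrite leq_addl.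
case/(indecomposable_coprime indM ca cop) => [qa | ]; last first.
  rewrite rmorphXn /= horner_mx_X => am; right.
  have -> : a ^+ n.+1 = a ^+ (n.+1 - m) * a ^+ m by rewrite -exprD subnK.
  by rewrite am mulr0.
left; have [r [c]] : exists r c, q = r * 'X + c%:P.
  by exists (q %/ 'X), (q.[0]); rewrite {1}(divp_eq q 'X) -['X]subr0 modp_XsubC.
move=> Eq; move: qa q0; rewrite Eq rmorphD rmorphM /= horner_mx_X horner_mx_C.
rewrite /root !hornerE => /eqP; rewrite addr_eq0 => /eqP ra c0.
suff /mulmx1_unit[] : ((- c^-1) *: horner_mx a r) *m a = 1%:M by [].
have {}ra : horner_mx a r *m a = - c%:M by exact: ra.
by rewrite -scalemxAl ra scalerN scaleNr opprK scale_scalar_mx mulVf.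
Qed.

Lemma nilpotent_sub1_unit n (a : 'M[K]_n.+1) m :
  a ^+ m = 0 -> 1 - a \in unitmx.
Proof.
move=> am; have := subrX1 a m; rewrite am sub0r => E.
suff /mulmx1_unit[]: (1 - a) *m (\sum_(i < m) a ^+ i) = 1%:M by [].
by apply: oppr_inj; rewrite -mulNmx opprB; exact: (esym E).
Qed.

Lemma indecomposable_local n (rM : reprG n.+1) (a : 'M[K]_n.+1) :
    indecomposable rM -> centgmx rM a ->
  a \in unitmx \/ 1 - a \in unitmx.
Proof.
move=> indM /(indecomposable_fitting indM)[|an]; [by left | right].
exact: nilpotent_sub1_unit an.
Qed.

(** Krull-Schmidt exchange: the two composites M -> N1 -> M and M -> N2 -> M
    add up to the identity, so one of them is invertible in the local ring of
    endomorphisms of M. *)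
Lemma indecomposable_summand_dadd n (rM : reprG n) (r1 r2 : representation K G) :
    indecomposable rM -> summand rM (dadd_grepr r1 r2) ->
  summand rM r1 \/ summand rM r2.
Proof.
case: n rM => [|n] rM indM; first by case: indM.
case=> A [B [AB rA rB]].
pose A1 := lsubmx A; pose A2 := rsubmx A.
pose B1 := usubmx B; pose B2 := dsubmx B.
have rA1 : intertwines rM r1 A1.
  move=> x Gx; have := rA x Gx; rewrite -[A]hsubmxK mul_mx_row mul_row_block.
  by rewrite !mulmx0 addr0 add0r => /eq_row_mx[].
have rA2 : intertwines rM r2 A2.
  move=> x Gx; have := rA x Gx; rewrite -[A]hsubmxK mul_mx_row mul_row_block.
  by rewrite !mulmx0 addr0 add0r => /eq_row_mx[].
have rB1 : intertwines r1 rM B1.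
  move=> x Gx; have := rB x Gx; rewrite /= -[B]vsubmxK mul_col_mx mul_block_col.
  by rewrite !mul0mx addr0 add0r => /eq_col_mx[].
have rB2 : intertwines r2 rM B2.
  move=> x Gx; have := rB x Gx; rewrite /= -[B]vsubmxK mul_col_mx mul_block_col.
  by rewrite !mul0mx addr0 add0r => /eq_col_mx[].
have finish m (r : reprG m) (C : 'M_(n.+1, m)) (D : 'M_(m, n.+1)) :
    intertwines rM r C -> intertwines r rM D -> C *m D \in unitmx ->
  summand rM r.
  move=> rC rD uCD; exists C, (D *m invmx (C *m D)); split=> //.
    by rewrite mulmxA mulmxV.
  apply: (intertwinesM (r2 := rM) rD) => x Gx.
  apply: (canRL (mulKmx uCD)); rewrite mulmxA -(intertwinesM rC rD Gx).
  by rewrite mulmxK.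
have c1 : centgmx rM (A1 *m B1) by apply/intertwines_cent/(intertwinesM rA1).
have AB12 : 1 - A1 *m B1 = A2 *m B2.
  rewrite -[1]AB -[A]hsubmxK -[B]vsubmxK mul_row_col.
  by rewrite addrC addKr.
have [u | ] := indecomposable_local indM c1; first by left; apply: finish u.
by rewrite AB12 => u; right; apply: finish u.
Qed.

End Summands.

(** * Modules defined over a subfield *)

Section DefinedOver.

Variables (k K : fieldType) (j : {rmorphism k -> K}).
Variables (gT : finGroupType) (G : {group gT}).

Definition defined_over n (rM : mx_representation K G n) : Prop :=
  exists (m : nat) (r0 : mx_representation k G m), mx_rsim rM (map_repr j r0).

(** The conjugated matrices need only have entries in k one by one: as j is
    injective, their preimages multiply as they should. *)
Lemma defined_over_entries n m (rM : mx_representation K G n)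
    (A : 'M[K]_(m, n)) (B : 'M[K]_(n, m)) :
    A *m B = 1%:M -> B *m A = 1%:M ->
    {in G, forall x, exists y : 'M[k]_m, A *m rM x *m B = map_mx j y} ->
  defined_over rM.
Proof.
move=> AB BA entries.
have /choice[f fP] x : exists y : 'M[k]_m, x \in G -> A *m rM x *m B = map_mx j y.
  have [Gx | _] := boolP (x \in G); last by exists 0.
  by have [y] := entries x Gx; exists y.
have f_repr : mx_repr G f.
  split=> [|x y Gx Gy]; apply: (map_mx_inj (f := j)).
    by rewrite -fP ?group1 // repr_mx1 mulmx1 AB map_mx1.
  rewrite map_mxM -!fP ?groupM // repr_mxM // !mulmxA.
  by rewrite -(mulmxA _ B) BA mulmx1.
exists m, (MxRepresentation f_repr).
apply: (mutual_inverse_rsim BA _ AB) => x Gx.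
by rewrite /= /map_repr_mx /= -fP // !mulmxA BA mul1mx.
Qed.

Lemma defined_over_rsim n m (rM : mx_representation K G n)
    (rN : mx_representation K G m) :
  mx_rsim rM rN -> defined_over rN -> defined_over rM.
Proof. by move=> MN [d [r0 N0]]; exists d, r0; apply: mx_rsim_trans N0. Qed.

Lemma defined_over_dadd (r1 r2 : representation K G) :
  defined_over r1 -> defined_over r2 -> defined_over (dadd_grepr r1 r2).
Proof.
case=> m1 [s1 sim1] [m2 [s2 sim2]].
have [A1 [B1 [AB1 BA1 rA1 _]]] := rsim_mutual_inverse sim1.
have [A2 [B2 [AB2 BA2 rA2 _]]] := rsim_mutual_inverse sim2.
exists (m1 + m2)%N.
exists (dadd_grepr (Representation s1) (Representation s2)).
apply: (@mutual_inverse_rsim _ _ _ _ _ _ _ (block_mx A1 0 0 A2) (block_mx B1 0 0 B2)).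
- by rewrite mulmx_block !(mulmx0, mul0mx, addr0, add0r) AB1 AB2 -scalar_mx_block.
- move=> x Gx; rewrite /= /map_repr_mx /= map_block_mx !map_mx0 !mulmx_block.
  by rewrite !(mulmx0, mul0mx, addr0, add0r) rA1 // rA2.
by rewrite mulmx_block !(mulmx0, mul0mx, addr0, add0r) BA1 BA2 -scalar_mx_block.
Qed.

Lemma defined_over_indecomposable :
    (forall n (rM : mx_representation K G n), indecomposable rM ->
      defined_over rM) ->
  forall n (rM : mx_representation K G n), defined_over rM.
Proof.
move=> ind n; have [d] := ubnP n; elim: d n => // d IHd n /ltnSE le_nd rM.
have [n0 | n_gt0] := posnP n.
  exists 0%N, (@grepr0 k gT G); exists (0 : 'M_(n, 0)) => // [|x _].
    by rewrite /row_free mxrank0 n0.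
  by rewrite mulmx0 mul0mx.
have [/ind // | dec] := pselect (indecomposable rM).
have [r1 [r2 [lt1 lt2 sim]]] := decomposableP n_gt0 dec.
apply: defined_over_rsim sim _; apply: defined_over_dadd; apply: IHd.
  exact: leq_trans le_nd.
exact: leq_trans le_nd.
Qed.

End DefinedOver.

(** * Induced modules and relative projectivity *)

Section Cosets.

Variables (gT : finGroupType) (G P : {group gT}).

Definition coset_rep (i : 'I_#|rcosets P G|) : gT :=
  repr (enum_val i : {set gT}).

Lemma coset_rep_mem (sPG : P \subset G) i : coset_rep i \in G.
Proof.
rewrite /coset_rep; have /rcosetsP[x Gx ->] := enum_valP i.
case: repr_rcosetP => h /(subsetP sPG) Gh; exact: groupM.
Qed.

(** This form of the uniqueness of coset representatives collapses every sum
    over cosets in a product of induced matrices to a single term. *)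
Lemma coset_rep_uniq z : z \in G ->
  exists i0, forall i, (z * (coset_rep i)^-1 \in P)%g = (i == i0).
Proof.
move=> Gz; have Pz : (P :* z)%g \in rcosets P G by apply/rcosetsP; exists z.
exists (enum_rank_in Pz (P :* z)%g) => i.
rewrite -mem_rcoset -(inj_eq enum_val_inj) enum_rankK_in // /coset_rep.
have /rcosetsP[x Gx ->] := enum_valP i.
by rewrite rcoset_repr eq_sym; apply/rcoset_eqP/eqP.
Qed.

End Cosets.

Section Induction.

Variables (K : fieldType) (gT : finGroupType) (G P : {group gT}).
Hypothesis sPG : P \subset G.
Local Notation m := #|rcosets P G|.
Local Notation r := (@coset_rep gT G P).

Section Def.

Variables (n : nat) (rP : mx_representation K P n).

Definition extend0 (x : gT) : 'M[K]_n := if x \in P then rP x else 0.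

(** Only the coset of z contributes to the sum. The multiplicativity of the
    induced matrices and their relation to rP are instances of this identity. *)
Lemma extend0_sum z w : z \in G ->
  \sum_i extend0 (z * (r i)^-1)%g *m extend0 (r i * w)%g = extend0 (z * w)%g.
Proof.
move=> Gz; have [i0 i0P] := coset_rep_uniq P Gz.
rewrite (bigD1 i0) //= big1 => [|i /negPf ne]; last first.
  by rewrite {1}/extend0 i0P ne mul0mx.
have Pz : (z * (r i0)^-1 \in P)%g by rewrite i0P.
have Dzw : (z * w = (z * (r i0)^-1) * (r i0 * w))%g by rewrite !mulgA mulgKV.
rewrite addr0 Dzw {1}/extend0 Pz /extend0 (groupMl _ Pz).
by case: ifP => Pw; rewrite ?mulmx0 -?repr_mxM.
Qed.

Definition induced_mx (x : gT) :=
  \mxblock_(i < m, j < m) extend0 (r i * x * (r j)^-1)%g.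

Lemma induced_mx_repr : mx_repr G induced_mx.
Proof.
split=> [|x y Gx Gy].
  rewrite -[1%:M]mxdiagZ; apply: eq_mxblock => i j.
  have [i0 i0P] := coset_rep_uniq P (coset_rep_mem sPG i).
  rewrite mulg1 /extend0 i0P eq_sym.
  have /eqP Ei : i == i0 by rewrite -i0P mulgV group1.
  rewrite -Ei eq_sym; case: eqP => [<- | //].
  by rewrite conform_mx_id mulgV repr_mx1.
rewrite mul_mxblock; apply: eq_mxblock => i j.
under eq_bigr => k _ do rewrite -[(r k * y * _)%g]mulgA.
rewrite extend0_sum ?groupM ?coset_rep_mem //.
by rewrite !mulgA.
Qed.

Definition induced_repr := MxRepresentation induced_mx_repr.

(** The summand is the block of the trivial coset; its inclusion and its
    projection are written as rows and columns of extend0 so that extend0_sum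
    applies. *)
Lemma summand_restrict_induced : summand rP (subg_repr induced_repr sPG).
Proof.
exists (\mxrow_(i < m) extend0 (r i)^-1%g), (\mxcol_(i < m) extend0 (r i)).
have G1 := group1 G; split=> [|x Px|x Px].
- rewrite mul_mxrow_mxcol.
  transitivity (\sum_i extend0 (1 * (r i)^-1)%g *m extend0 (r i * 1)%g).
    by apply: eq_bigr => i _; rewrite mul1g mulg1.
  by rewrite extend0_sum // mulg1 /extend0 group1 repr_mx1.
- rewrite mul_mxrow mul_mxrow_mxblock; apply: eq_mxrow => j.
  transitivity (extend0 (x * (r j)^-1)%g).
    by rewrite /extend0 groupMl //; case: ifP => Pj; rewrite ?mulmx0 ?repr_mxM.
  rewrite -[(x * _)%g]mul1g -extend0_sum //; apply: eq_bigr => i _.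
  by rewrite mul1g -mulgA.
rewrite mul_mxblock_mxrow mxcol_mul; apply: eq_mxcol => i.
transitivity (extend0 (r i * x)%g); last first.
  by rewrite /extend0 groupMr //; case: ifP => Pj; rewrite ?mul0mx ?repr_mxM.
have Gz : (r i * x)%g \in G by rewrite groupM ?coset_rep_mem ?(subsetP sPG).
have := extend0_sum 1 Gz; rewrite mulg1 => <-.
by apply: eq_bigr => j _; rewrite mulg1.
Qed.

End Def.

(** Higman's criterion. The map v |-> (v r_i^-1)_i to the induced module and the
    map (v_i)_i |-> sum_i v_i r_i back are G-linear, and their composite is
    multiplication by the index. Composing with a split embedding of the
    restriction of rM in rP allows rP to be a larger or a conjugate module. *)
Lemma summand_induced n d (rM : mx_representation K G n)
    (rP : mx_representation K P d) :
    #|G : P|%g%:R != 0 :> K -> summand (subg_repr rM sPG) rP ->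
  summand rM (induced_repr rP).
Proof.
move=> idx [A [B [AB rA rB]]].
exists ((#|G : P|%g%:R^-1) *: \mxrow_(i < m) (rM (r i)^-1%g *m A)).
exists (\mxcol_(i < m) (B *m rM (r i))).
have Gr := coset_rep_mem sPG.
split=> [|x Gx|x Gx].
- rewrite -scalemxAl mul_mxrow_mxcol (eq_bigr (fun=> 1%:M)); last first.
    move=> i _; rewrite mulmxA -(mulmxA _ A) AB mulmx1 -repr_mxM ?groupV ?Gr //.
    by rewrite mulVg repr_mx1.
  by rewrite sumr_const card_ord -scaler_nat scalerA mulVf // scale1r.
- rewrite -scalemxAr -scalemxAl mul_mxrow mul_mxrow_mxblock; congr (_ *: _).
  apply: eq_mxrow => j.
  have Gz : (x * (r j)^-1)^-1%g \in G by rewrite groupV groupM ?groupV ?Gr.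
  have [i0 i0P] := coset_rep_uniq P Gz.
  have Dh i : ((r i * x * (r j)^-1)%g \in P) = (i == i0).
    by rewrite -i0P -groupV !invMg !invgK !mulgA.
  rewrite (bigD1 i0) //= big1 => [|i /negPf ne]; last first.
    by rewrite /extend0 Dh ne mulmx0.
  have Grj : (r j)^-1%g \in G by rewrite groupV Gr.
  have Gri : (r i0)^-1%g \in G by rewrite groupV Gr.
  have Gh : (r i0 * x * (r j)^-1)%g \in G by rewrite !groupM ?Gr.
  rewrite addr0 /extend0 Dh eqxx -mulmxA -rA ?Dh //= !mulmxA -!repr_mxM //.
  by rewrite !mulgA mulVg mul1g.
rewrite mul_mxblock_mxrow mxcol_mul; apply: eq_mxcol => i.
have Gz : (r i * x)%g \in G by rewrite groupM ?Gr.
have [j0 j0P] := coset_rep_uniq P Gz.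
rewrite (bigD1 j0) //= big1 => [|j /negPf ne]; last first.
  by rewrite /extend0 j0P ne mul0mx.
rewrite addr0 /extend0 j0P eqxx mulmxA rB ?j0P //= -!mulmxA -!repr_mxM ?Gr //.
  by rewrite mulgKV.
by rewrite groupM ?groupV ?Gr.
Qed.

End Induction.

Lemma map_induced (k K : fieldType) (j : {rmorphism k -> K})
    (gT : finGroupType) (G P : {group gT}) (sPG : P \subset G) n
    (rP : mx_representation k P n) x :
  map_repr j (induced_repr sPG rP) x = induced_repr sPG (map_repr j rP) x.
Proof.
apply/matrixP=> s t; rewrite !mxE /extend0 /=.
by case: ifP => _; rewrite !mxE ?rmorph0.
Qed.

(** * Modules for cyclic p-groups *)

Section JordanBlock.

Definition shift_mx (R : pzSemiRingType) s : 'M[R]_s :=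
  \matrix_(i, j) (j == i.+1 :> nat)%:R.

Lemma map_shift_mx (R S : nzRingType) (f : {rmorphism R -> S}) s :
  map_mx f (shift_mx R s) = shift_mx S s.
Proof. by apply/matrixP=> i j; rewrite !mxE rmorph_nat. Qed.

(** A Jordan block of maximal size splits off. Let N^s be the last nonzero
    power of N, and v N^s be nonzero: the rows of A are v, vN, ..., vN^s; the columns
    of B are N^s w, ..., Nw, w for a column w with v N^i w = 0 for i < s and
    v N^s w = 1. Then AB = 1 because v N^(i + s - j) w is 1 if i = j and 0
    otherwise. *)
Lemma jordan_summand (K : fieldType) n (N : 'M[K]_n.+1) q : N ^+ q = 0 ->
  exists s (A : 'M[K]_(s.+1, n.+1)) (B : 'M[K]_(n.+1, s.+1)),
    [/\ A *m B = 1%:M, shift_mx K s.+1 *m A = A *m N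
      & B *m shift_mx K s.+1 = N *m B].
Proof.
move=> Nq; have exN : exists m, N ^+ m == 0 by exists q; rewrite Nq.
case: (ex_minnP exN) => -[|s] /eqP Ns minN; first by move/eqP: Ns; rewrite oner_eq0.
have Ns0 : N ^+ s != 0 by apply/negP=> /minN; rewrite ltnn.
have Nbig i : (s < i)%N -> N ^+ i = 0.
  by move=> lt_si; rewrite -(subnK lt_si) exprD Ns mulr0.
have [i0 v0] : exists i, row i (N ^+ s) != 0.
  by apply/existsP; rewrite -negb_forall; apply: contra Ns0 => /forallP z;
     apply/eqP/row_matrixP=> i; rewrite row0; apply/eqP.
pose v : 'rV[K]_n.+1 := delta_mx 0 i0.
have {}v0 : v *m N ^+ s != 0 by rewrite -rowE.
pose A : 'M[K]_(s.+1, n.+1) := \matrix_i (v *m N ^+ i).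
have freeA : row_free A.
  (* In a relation between the v N^i, multiplying by N^(s - m) isolates the
     coefficient u_m once those before it are known to vanish. *)
  rewrite -kermx_eq0 -submx0; apply/rV_subP=> u; rewrite sub_kermx submx0 => /eqP uA.
  have {}uA : \sum_i u 0 i *: (v *m N ^+ i) = 0.
    rewrite -[RHS]uA mulmx_sum_row; apply: eq_bigr => i _; by rewrite rowK.
  suff u0 m : forall i : 'I_s.+1, (i < m)%N -> u 0 i = 0.
    by apply/eqP/rowP=> i; rewrite mxE; apply: (u0 s.+1).
  elim: m => // m IHm i; rewrite ltnS leq_eqVlt => /orP[/eqP im | /IHm //].
  have := congr1 (mulmx^~ (N ^+ (s - m))) uA; rewrite /= mul0mx mulmx_suml.
  rewrite (bigD1 i) //= big1 => [|l ne_li].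
    rewrite addr0 -scalemxAl -mulmxA -[_ *m N ^+ _]exprD im subnKC -?im -1?ltnS //.
    by move/eqP; rewrite scaler_eq0 (negPf v0) orbF => /eqP.
  have [lt_lm | le_ml] := ltnP l m; first by rewrite IHm // scale0r mul0mx.
  rewrite -scalemxAl -mulmxA -[_ *m N ^+ _]exprD Nbig ?mulmx0 ?scaler0 //.
  have lt_ml : (m < l)%N by rewrite ltn_neqAle le_ml andbT -im eq_sym.
  have le_ms : (m <= s)%N by rewrite -im -ltnS.
  by rewrite -{1}(subnKC le_ms) ltn_add2r.
have [A' AA'] := row_freeP freeA.
have [w Dw] : exists w : 'cV[K]_n.+1, A *m w = delta_mx ord_max 0.
  by exists (A' *m delta_mx ord_max 0); rewrite mulmxA AA' mul1mx.
have vw i : (i <= s)%N -> v *m N ^+ i *m w = (i == s)%:R%:M.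
  move=> le_is; have Ai : v *m N ^+ i = row (inord i : 'I_s.+1) A by rewrite rowK inordK.
  rewrite Ai -row_mul Dw; apply/matrixP=> a b.
  by rewrite !ord1 !mxE -val_eqE /= inordK // eqxx mulr1n andbT.
pose B : 'M[K]_(n.+1, s.+1) := \matrix_(i, j) (N ^+ (s - j) *m w) i 0.
have colB j : col j B = N ^+ (s - j) *m w.
  by apply/colP=> i; rewrite !mxE.
exists s, A, B; split.
- apply/matrixP=> i j; rewrite !mxE.
  transitivity ((v *m N ^+ (i + (s - j)) *m w) 0 0).
    rewrite exprD [_ * _]/(_ *m _) mulmxA -(mulmxA _ _ w) mxE.
    by apply: eq_bigr => l _; rewrite !mxE.
  have le_js : (j <= s)%N by rewrite -ltnS.
  have [lt_ji | le_ij] := ltnP j i.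
    rewrite Nbig ?mulmx0 ?mul0mx ?mxE; last by rewrite -{1}(subnKC le_js) ltn_add2r.
    by rewrite -val_eqE /= gtn_eqF.
  rewrite vw; last by rewrite addnBA // leq_subLR leq_add2r.
  by rewrite !mxE eqxx mulr1n -[X in _ == X](subnKC le_js) eqn_add2r.
- apply/row_matrixP=> i; rewrite !row_mul rowK -mulmxA -[_ *m N]exprSr.
  have -> : row i (shift_mx K s.+1) *m A = \sum_(l < s.+1) (l == i.+1 :> nat)%:R *: row l A.
    by rewrite mulmx_sum_row; apply: eq_bigr => l _; rewrite !mxE.
  have [lt_is | le_si] := ltnP i s.
    have lt_is1 : (i.+1 < s.+1)%N by [].
    rewrite (bigD1 (Ordinal lt_is1)) //= eqxx scale1r rowK big1 ?addr0 // => l.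
    by rewrite -val_eqE => /negPf /= ->; rewrite scale0r.
  rewrite Nbig ?mulmx0 ?big1 // => l _.
  by rewrite ltn_eqF ?scale0r // (leq_trans (ltn_ord l)).
apply/trmx_inj/row_matrixP=> j; rewrite -!tr_col; congr trmx.
rewrite [RHS]colE -mulmxA -colE colB mulmxA -[N *m _]exprS.
have -> : col j (B *m shift_mx K s.+1) = \sum_(l < s.+1) (j == l.+1 :> nat)%:R *: col l B.
  by apply/colP=> i; rewrite summxE !mxE; apply: eq_bigr => l _; rewrite !mxE mulrC.
case: j => -[|j] lt_js /=.
  rewrite big1 => [|l _]; first by rewrite subn0 Ns mul0mx.
  by rewrite scale0r.
have lt_js1 : (j < s.+1)%N by apply: ltnW.
rewrite (bigD1 (Ordinal lt_js1)) //= eqxx scale1r colB big1 ?addr0 /= => [|l].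
  by rewrite -subSn // subSS.
by rewrite -val_eqE eqSS eq_sym => /negPf /= ->; rewrite scale0r.
Qed.

End JordanBlock.

(** By the previous lemma a generator of P acts on an indecomposable module as 1
    plus the nilpotent shift matrix, whose entries lie in every field. *)
Lemma defined_over_cyclic (p : nat) (k K : fieldType) (j : {rmorphism k -> K})
    (gT : finGroupType) (P : {group gT}) n (rP : mx_representation K P n) :
  p \in [pchar K] -> p.-group%g P -> cyclic P -> defined_over j rP.
Proof.
move=> pK pP /cyclicP[g DP]; move: n rP; apply: defined_over_indecomposable.
move=> [|n] rP indP; first by case: indP.
have Pg : g \in P by rewrite DP cycle_id.
pose N := rP g - 1.
have Nq : N ^+ #|P| = 0.
  have cN : [pchar {poly K}].-nat #|P|.
    rewrite (eq_pnat _ (pchar_poly K)) (eq_pnat _ (pcharf_eq pK)) //.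
  have EP : ('X - 1 : {poly K}) ^+ #|P| = 'X^#|P| - 1.
    by rewrite exprDn_pchar // exprNn_pchar // expr1n.
  have := congr1 (horner_mx (rP g)) EP.
  rewrite rmorphXn !rmorphB /= rmorphXn rmorph1 /= horner_mx_X => ->.
  by rewrite -repr_mxX // expg_cardG // repr_mx1 subrr.
have [s [A [B [AB ZA BZ]]]] := jordan_summand Nq.
have rPg : rP g = 1 + N by rewrite addrC subrK.
have cBA : centgmx rP (B *m A).
  apply/centgmxP=> x; rewrite {1}DP => /cycleP[i ->].
  rewrite repr_mxX // rPg; apply: (@commrX _ (B *m A) (1 + N) i).
  apply: commrD; first exact: commr1.
  have : B *m A *m N = N *m (B *m A) by rewrite -mulmxA -ZA mulmxA BZ -mulmxA.
  exact.
have BA : B *m A = 1%:M.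
  have [_ idP] := indP; case: (idP _ cBA); rewrite ?mulmxA //.
    by rewrite -(mulmxA B) AB mulmx1.
  move=> BA0; have := congr1 (mulmx^~ B \o mulmx A) BA0.
  rewrite /= mulmx0 mul0mx mulmxA AB mul1mx AB => /eqP.
  by rewrite (oner_eq0 ('M[K]_s.+1)).
apply: (@defined_over_entries _ _ _ _ _ _ _ _ A B) => // x.
rewrite {1}DP => /cycleP[i ->]; exists ((1 + shift_mx k s.+1) ^+ i).
rewrite rmorphXn rmorphD rmorph1 /= map_shift_mx repr_mxX // rPg.
elim: i => [|i IHi]; first by rewrite !expr0 mulmx1.
have NB : (1 + N) *m B = B *m (1 + shift_mx K s.+1).
  by rewrite mulmxDr mulmx1 BZ mulmxDl mul1mx.
transitivity (A *m (1 + N) ^+ i *m ((1 + N) *m B)).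
  by rewrite exprSr !mulmxA.
by rewrite NB mulmxA IHi exprSr.
Qed.

(** * Finite division rings *)

Section FiniteDivisionSubring.

Variables (R : finUnitRingType) (S : {pred R}).
Hypothesis S_closed : divring_closed S.
Hypothesis S_unit : {in S, forall x, x != 0 -> x \is a GRing.unit}.
HB.instance Definition _ := GRing.isDivringClosed.Build R S S_closed.

Record divsub := DivSub {divsub_val :> R; _ : divsub_val \in S}.
HB.instance Definition _ := [isSub for divsub_val].
HB.instance Definition _ := [Finite of divsub by <:].
HB.instance Definition _ := [SubChoice_isSubUnitRing of divsub by <:].

Let divsub_domain : GRing.integral_domain_axiom divsub.
Proof.
move=> x y xy0; case: (eqVneq x 0) => //= x0; apply/eqP/val_inj => /=.
have ux : val x \is a GRing.unit.
  by apply: S_unit; [exact: valP | apply: contra x0 => /eqP x0; apply/eqP/val_inj].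
by apply: (mulrI ux); rewrite mulr0 -[_ * _]/(val (x * y)) xy0.
Qed.

(** Wedderburn's little theorem makes the division ring S a finite field; the
    element a generates the multiplicative group of this field, and q is the
    number of elements of the field. *)
Lemma finite_division_subring p : p \in [pchar R] ->
  exists2 a, a \in S & exists2 q, (1 < q)%N && p.-nat q &
    {in S, forall x, x ^+ q = x} /\
    {in S, forall x, x != 0 -> exists i, x = a ^+ i}.
Proof.
move=> pR; pose L := FinDomainFieldType divsub_domain.
have /cyclicP[g genL] := field_unit_group_cyclic [set: {unit L}].
pose a : divsub := val g; exists (val a); first exact: valP.
have pL : p \in [pchar L].
  case/andP: (pR) => p_pr /eqP pR0; apply/andP; split=> //; apply/eqP.
  have valMn n : divsub_val (n%:R : L) = n%:R.
    by elim: n => // n IHn; rewrite !mulrS -IHn.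
  by apply: (val_inj : injective divsub_val); rewrite valMn pR0.
have valX (x : L) i : divsub_val (x ^+ i) = divsub_val x ^+ i.
  by elim: i => // i IHi; rewrite !exprS -IHi.
exists #|L|.
  rewrite finNzRing_gt1 /=.
  by have /and3P[] := fin_ring_pchar_abelem pL; rewrite /pgroup cardsT.
split=> x Sx.
  have := expf_card (DivSub Sx : L) => /(congr1 divsub_val).
  by rewrite valX.
move=> x0; have ux : (DivSub Sx : L) \is a GRing.unit.
  by rewrite unitfE; apply: contra x0 => /eqP/(congr1 divsub_val) /= ->.
have : FinRing.unit L ux \in [set: {unit L}] by rewrite inE.
rewrite genL => /cycleP[i /(congr1 val)] /=; rewrite FinRing.val_unitX.
move=> /(congr1 divsub_val) /= ->.
by exists i; rewrite valX.
Qed.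

End FiniteDivisionSubring.

(** * Local matrix algebras over a finite field *)

Section ScalarExtensionSpan.

Variables (k : finFieldType) (K : fieldType) (j : {rmorphism k -> K}) (d : nat).
Implicit Types (S T U : {pred 'M[k]_d.+1}) (X Y : 'M[K]_d.+1).

(** Membership in the image of K (x) S in the matrix algebra over K. As k is
    finite, all of S can serve as a spanning family. *)
Definition kspan S X : Prop :=
  exists w : 'M[k]_d.+1 -> K, X = \sum_(c | c \in S) w c *: map_mx j c.

Lemma kspan0 S : kspan S 0.
Proof. by exists (fun=> 0); rewrite big1 // => c _; rewrite scale0r. Qed.

Lemma kspanD S X Y : kspan S X -> kspan S Y -> kspan S (X + Y).
Proof.
move=> [w ->] [v ->]; exists (fun c => w c + v c).
by rewrite -big_split; apply: eq_bigr => c _; rewrite scalerDl.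
Qed.

Lemma kspanZ S a X : kspan S X -> kspan S (a *: X).
Proof.
move=> [w ->]; exists (fun c => a * w c).
by rewrite scaler_sumr; apply: eq_bigr => c _; rewrite scalerA.
Qed.

Lemma kspanN S X : kspan S X -> kspan S (- X).
Proof. by rewrite -scaleN1r; apply: kspanZ. Qed.

Lemma kspan_map S c : c \in S -> kspan S (map_mx j c).
Proof.
move=> Sc; exists (fun x => (x == c)%:R).
rewrite (bigD1 c) //= eqxx scale1r big1 ?addr0 // => x /andP[_ /negPf->].
by rewrite scale0r.
Qed.

Lemma kspan_ind (Q : 'M[K]_d.+1 -> Prop) S X :
    Q 0 -> (forall Y Z, Q Y -> Q Z -> Q (Y + Z)) ->
    (forall a c, c \in S -> Q (a *: map_mx j c)) ->
  kspan S X -> Q X.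
Proof. by move=> Q0 QD Qm [w ->]; apply: big_ind => // c Sc; apply: Qm. Qed.

Lemma kspanM S T U X Y :
    (forall a b, a \in S -> b \in T -> a * b \in U) ->
  kspan S X -> kspan T Y -> kspan U (X * Y).
Proof.
move=> STU SX TY.
apply: (kspan_ind (Q := fun Z => kspan U (Z * Y)) _ _ _ SX) => [|Z W UZ UW|a c Sc].
- by rewrite mul0r; apply: kspan0.
- by rewrite mulrDl; apply: kspanD.
apply: (kspan_ind (Q := fun Z => kspan U (_ * Z)) _ _ _ TY) => [|Z W UZ UW|b e Te].
- by rewrite mulr0; apply: kspan0.
- by rewrite mulrDr; apply: kspanD.
rewrite -scalerAl -scalerAr; do 2 apply: kspanZ.
by rewrite -[_ * _]/(_ *m _) -map_mxM; apply: kspan_map; apply: STU.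
Qed.

Lemma kspan_horner S a (H : {poly K}) :
    1 \in S -> (forall x, x \in S -> x * a \in S) ->
  kspan S (horner_mx (map_mx j a) H).
Proof.
move=> S1 Sa; elim/poly_ind: H => [|H c IH]; first by rewrite rmorph0; apply: kspan0.
rewrite rmorphD rmorphM /= horner_mx_X horner_mx_C; apply: kspanD.
  apply: kspanM IH (kspan_map (S := pred1 a) (eqxx _)) => x y Sx /eqP->.
  exact: Sa.
by rewrite -scalemx1 -(map_mx1 j); apply: kspanZ; apply: kspan_map.
Qed.

End ScalarExtensionSpan.

(** E is a local algebra of matrices acting on row vectors on the right, and J
    its set of nonunits, which is the Jacobson radical. The nilpotency of
    J and the structure of E/J are read off from E-stable row spaces rather than
    from the ring E itself. *)
Section LocalMatrixAlgebra.

Variables (k : finFieldType) (d : nat) (E : {pred 'M[k]_d.+1}).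
Hypothesis E1 : 1 \in E.
Hypothesis EB : {in E &, forall a b, a - b \in E}.
Hypothesis EM : {in E &, forall a b, a * b \in E}.
Hypothesis EV : {in E, forall a, a^-1 \in E}.
Hypothesis EZ : forall c a, a \in E -> c *: a \in E.
Hypothesis E_local :
  {in E, forall a, a \in unitmx \/ 1 - a \in unitmx}.

Let E0 : 0 \in E. Proof. by rewrite -(subrr 1) EB. Qed.
Let EN a : a \in E -> - a \in E. Proof. by rewrite -sub0r; apply: EB. Qed.
Let ED a b : a \in E -> b \in E -> a + b \in E.
Proof. by move=> Ea Eb; rewrite -[b]opprK EB ?EN. Qed.

Definition nonunit : {pred 'M[k]_d.+1} :=
  [pred a in E | a \notin unitmx].

Local Notation J := nonunit.

Lemma nonunit_mem a : a \in J -> a \in E. Proof. by case/andP. Qed.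

Lemma nonunitMr a b : a \in J -> b \in E -> a * b \in J.
Proof. by case/andP=> Ea ua Eb; rewrite inE EM //= unitmx_mul negb_and ua. Qed.

Lemma nonunitMl a b : a \in J -> b \in E -> b * a \in J.
Proof.
by case/andP=> Ea ua Eb; rewrite inE EM //= unitmx_mul negb_and ua orbT.
Qed.

Lemma nonunit_sub1 a : a \in J -> 1 - a \in unitmx.
Proof. by case/andP=> Ea /negPf ua; case: (E_local Ea) => //; rewrite ua. Qed.

Definition stable (U : 'M[k]_d.+1) :=
  [forall g, (g \in E) ==> (U *m g <= U)%MS].

Lemma stableP (U : 'M[k]_d.+1) :
  reflect {in E, forall g, (U *m g <= U)%MS} (stable U).
Proof.
apply: (iffP forallP) => [st g Eg | st g]; first exact: implyP (st g) Eg.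
by apply/implyP; apply: st.
Qed.

Definition orbit_span (v : 'rV[k]_d.+1) : 'M[k]_d.+1 :=
  (\sum_(g | g \in E) <<v *m g>>)%MS.

(** The vectors v g already form a subspace, E being one. *)
Lemma orbit_spanP (v w : 'rV[k]_d.+1) :
  reflect (exists2 g, g \in E & w = v *m g) (w <= orbit_span v)%MS.
Proof.
apply: (iffP idP) => [/sub_sumsmxP[c ->] | [g Eg ->]]; last first.
  by apply: (sumsmx_sup g); rewrite // genmxE.
have /choice[x xP] g : exists x : k, c g *m <<v *m g>>%MS = x *: (v *m g).
  apply/sub_rVP; apply: submx_trans (submxMl _ _) _; by rewrite genmxE.
exists (\sum_(g | g \in E) x g *: g).
  apply: (big_ind (fun g => g \in E)) => [|g h Eg Eh|g Eg]; first exact: E0.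
    exact: ED.
  exact: EZ.
by rewrite mulmx_sumr; apply: eq_bigr => g _; rewrite xP scalemxAr.
Qed.

Lemma stable_orbit_span v : stable (orbit_span v).
Proof.
apply/stableP=> g Eg; apply/row_subP=> i; rewrite row_mul.
have /orbit_spanP[h Eh ->] := row_sub i (orbit_span v).
by apply/orbit_spanP; exists (h * g); rewrite ?EM // mulmxA.
Qed.

(** If U' is maximal among the stable proper subspaces of U, then J maps U into
    U'. Otherwise some v a, with v in U and a in J, generates U modulo U', so
    v = v a g modulo U' for some g in E, and v lies in U' since 1 - a g is
    invertible. *)
Lemma nonunit_stable (U U' : 'M[k]_d.+1) :
    stable U -> stable U' -> (U' <= U)%MS ->
    (forall X, stable X -> (U' <= X)%MS -> (X <= U)%MS -> ~~ (U <= X)%MS ->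
       (X <= U')%MS) ->
  {in J, forall a, (U *m a <= U')%MS}.
Proof.
move=> /stableP sU /stableP sU' leU'U maxU' a Ja; have Ea := nonunit_mem Ja.
apply/row_subP=> i; rewrite row_mul; move: (row i U) (row_sub i U) => v Uv.
have [// | notU'] := boolP (v *m a <= U')%MS.
pose X := (U' + orbit_span (v *m a))%MS.
have sX : stable X.
  apply/stableP=> g Eg; rewrite addsmxMr; apply: addsmxS; first exact: sU'.
  exact: (stableP _ (stable_orbit_span _)).
have leXU : (X <= U)%MS.
  rewrite addsmx_sub leU'U; apply/sumsmx_subP=> g Eg; rewrite genmxE -mulmxA.
  by apply: submx_trans (submxMr _ Uv) (sU _ (EM Ea Eg)).
have vaX : (v *m a <= X)%MS.
  apply: submx_trans (addsmxSr _ _); apply/orbit_spanP; exists 1 => //.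
  by rewrite mulmx1.
have [leUX | nUX] := boolP (U <= X)%MS; last first.
  by have := submx_trans vaX (maxU' _ sX (addsmxSl _ _) leXU nUX); rewrite (negPf notU').
have /sub_addsmxP[[u1 u2] /= Dv] := submx_trans Uv leUX.
have /orbit_spanP[g Eg Du2] : (u2 *m orbit_span (v *m a) <= orbit_span (v *m a))%MS.
  exact: submxMl.
have Jag := nonunitMr Ja Eg.
have vag : (v *m (1 - a * g) <= U')%MS.
  by rewrite mulmxBr mulmx1 {1}Dv Du2 mulmxA addrK submxMl.
have Ev : (1 - a * g)^-1 \in E by rewrite EV ?EB ?EM.
have vU' : (v <= U')%MS.
  rewrite -[v](mulmxK (nonunit_sub1 Jag)).
  exact: submx_trans (submxMr _ vag) (sU' _ Ev).
by rewrite (submx_trans (submxMr _ vU') (sU' _ Ea)) in notU'.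
Qed.

(** Each factor lowers the rank, by the previous lemma. *)
Lemma nonunit_prod_stable (s : seq 'M[k]_d.+1) (U : 'M[k]_d.+1) :
  stable U -> (\rank U <= size s)%N -> {subset s <= J} ->
  U *m \prod_(a <- s) a = 0.
Proof.
elim: s U => [|a s IHs] U sU.
  by rewrite leqn0 mxrank_eq0 => /eqP->; rewrite mul0mx.
move=> rkU sJ; have [-> | U0] := eqVneq U 0; first by rewrite mul0mx.
pose Q X := stable X && (X < U)%MS.
have Q0 : Q 0.
  apply/andP; split; first by apply/stableP=> g _; rewrite mul0mx sub0mx.
  by rewrite lt0mx.
case: (arg_maxnP (@mxrank k _ _) Q0) => U' /andP[sU' ltU'] maxU'.
have leU : (U *m a <= U')%MS.
  apply: nonunit_stable (sJ _ (mem_head _ _)) => //; first exact: ltmxW.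
  move=> X sX leU'X leXU nUX.
  have /maxU' : Q X by rewrite /Q sX /ltmx leXU.
  by rewrite /= (geq_leqif (mxrank_leqif_sup leU'X)).
rewrite big_cons mulmxA; have /submxP[C ->] := leU.
rewrite -mulmxA IHs ?mulmx0 // => [|b sb]; last by apply: sJ; rewrite inE sb orbT.
by rewrite -ltnS; apply: leq_trans rkU; apply: rank_ltmx.
Qed.

Lemma nonunit_prod (s : seq 'M[k]_d.+1) :
  size s = d.+1 -> {subset s <= J} -> \prod_(a <- s) a = 0.
Proof.
move=> sz sJ; rewrite -[LHS]mul1mx; apply: nonunit_prod_stable => //.
  by apply/stableP=> g _; rewrite submx1.
by rewrite mxrank1 sz.
Qed.

(** The ideal J itself, and not only each of its elements, is nilpotent, which
    is what survives the extension of scalars: expanding a power of X leaves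
    products of d + 1 elements of J. *)
Lemma nonunit_kspan_nilpotent (K : fieldType) (j : {rmorphism k -> K}) X :
  kspan j J X -> X ^+ d.+1 = 0.
Proof.
move=> [w DX].
suff nil n : forall s : seq 'M[k]_d.+1, (size s + n)%N = d.+1 ->
    {subset s <= J} -> map_mx j (\prod_(a <- s) a) * X ^+ n = 0.
  by have := nil d.+1 [::] (erefl _); rewrite big_nil map_mx1 mul1r; apply.
elim: n => [|n IHn] s sz sJ.
  by rewrite addn0 in sz; rewrite nonunit_prod // map_mx0 mul0r.
rewrite exprS mulrA {1}DX mulr_sumr mulr_suml big1 // => c Jc.
have := IHn (rcons s c); rewrite size_rcons addSnnS => /(_ sz).
rewrite big_rcons /= map_mxM => nil.
rewrite -scalerAr -scalerAl -[_ * map_mx j _]/(_ *m _) nil ?scaler0 // => x.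
by rewrite mem_rcons inE => /predU1P[-> // | /sJ].
Qed.

(** The rows of R form a basis of a minimal nonzero stable subspace, whose
    maximal stable proper subspace is 0. *)
Lemma stable_killed_by_nonunits : exists r (R : 'M[k]_(r.+1, d.+1)),
  [/\ row_free R, {in E, forall g, (R *m g <= R)%MS}
    & {in J, forall a, R *m a = 0}].
Proof.
pose Q X := stable X && (X != 0).
have Q1 : Q 1%:M.
  by rewrite /Q oner_eq0 andbT; apply/stableP=> g _; rewrite submx1.
case: (arg_minnP (@mxrank k _ _) Q1) => U /andP[sU U0] minU.
have UJ : {in J, forall a, (U *m a <= (0 : 'M_d.+1))%MS}.
  apply: nonunit_stable => //; first by apply/stableP=> g _; rewrite mul0mx sub0mx.
    exact: sub0mx.
  move=> X sX _ leXU nUX; have [// | nX0] := boolP (X <= (0 : 'M_d.+1))%MS.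
  have /minU : Q X by rewrite /Q sX -submx0.
  by rewrite /= (geq_leqif (mxrank_leqif_sup leXU)) => leUX; case/negP: nUX.
case Dr: (\rank U) (row_base U) (row_base_free U) (eq_row_base U) => [|r] R fR eqR.
  by case/eqP: U0; apply/eqP; rewrite -mxrank_eq0 Dr.
exists r, R; split=> // [g Eg | a Ja].
  by rewrite eqR (eqmxMr g eqR) (stableP _ sU).
by apply/eqP; rewrite -submx0 (eqmxMr a eqR) UJ.
Qed.

(** The action phi of E on a subspace killed by J identifies E/J with a finite
    ring of matrices in which the nonzero elements are invertible. *)
Lemma residue_field_generator p : p \in [pchar k] ->
  exists2 a, a \in E & exists2 q, (1 < q)%N && p.-nat q &
    {in E, forall x, x ^+ q - x \in J} /\
    {in E, forall x, x \in J \/ exists i, x - a ^+ i \in J}.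
Proof.
move=> pk; have [r [R [freeR ER RJ]]] := stable_killed_by_nonunits.
have [R' RR'] := row_freeP freeR.
pose phi g : 'M[k]_r.+1 := R *m g *m R'.
have phiP g : g \in E -> R *m g = phi g *m R.
  move=> Eg; have /submxP[C DC] := ER g Eg.
  by rewrite /phi DC -!mulmxA (mulmxA R) RR' mul1mx.
have phi1 : phi 1 = 1 by rewrite /phi mulmx1 RR'.
have phiB g h : phi (g - h) = phi g - phi h by rewrite /phi mulmxBr mulmxBl.
have phiM g h : g \in E -> phi (g * h) = phi g * phi h.
  move=> Eg; transitivity (phi g *m R *m h *m R').
    by rewrite -phiP // /phi [g * h]/(g *m h) mulmxA.
  by move: (phi g) => A; rewrite /phi -2!mulmxA -(mulmxA R h R').
have phiX g i : g \in E -> phi (g ^+ i) = phi g ^+ i.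
  by move=> Eg; elim: i => // i IHi; rewrite !exprS phiM // IHi.
have phi_unit g : g \in E -> g \in unitmx -> phi g * phi g^-1 = 1.
  by move=> Eg ug; rewrite -phiM // mulrV.
have phi0 g : g \in E -> (phi g == 0) = (g \in J).
  move=> Eg; apply/eqP/idP => [g0 | Jg]; last by rewrite /phi RJ // mul0mx.
  rewrite inE Eg; apply/negP=> /(phi_unit _ Eg); rewrite g0 mul0r => /esym/eqP.
  by rewrite oner_eq0.
pose S : {pred 'M[k]_r.+1} := [pred A | [exists g, (g \in E) && (A == phi g)]].
have SP A : reflect (exists2 g, g \in E & A = phi g) (A \in S).
  apply: (iffP existsP) => [[g /andP[Eg /eqP->]] | [g Eg ->]]; exists g => //.
  by rewrite Eg eqxx.
have phi_inv g : g \in E -> g \in unitmx -> (phi g)^-1 = phi g^-1.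
  move=> Eg ug; have := phi_unit _ Eg ug; have [u _] := mulmx1_unit (phi_unit _ Eg ug).
  by move/(canRL (mulKr u)); rewrite mulr1.
have S_unit : {in S, forall x, x != 0 -> x \is a GRing.unit}.
  move=> _ /SP[g Eg ->]; rewrite phi0 // inE Eg negbK => /(phi_unit _ Eg).
  by case/mulmx1_unit.
have SV : {in S, forall x, x^-1 \in S}.
  move=> _ /SP[g Eg ->]; have [/eqP g0 | nz] := boolP (phi g == 0).
    by rewrite g0 invr0 -g0; apply/SP; exists g.
  have ug : g \in unitmx by move: nz; rewrite phi0 // inE Eg negbK.
  by rewrite phi_inv //; apply/SP; exists g^-1; rewrite ?EV.
have S_closed : divring_closed S.
  split; first by apply/SP; exists 1.
    by move=> _ _ /SP[g Eg ->] /SP[h Eh ->]; apply/SP; exists (g - h); rewrite ?EB.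
  move=> x y /SP[g Eg ->] /SV/SP[h Eh ->]; apply/SP; exists (g * h).
    exact: EM.
  by rewrite phiM.
have pM : p \in [pchar 'M[k]_r.+1].
  by rewrite (pchar_lalg 'M[k]_r.+1).
have [_ /SP[a Ea ->] [q pq [Sq Sa]]] := finite_division_subring S_closed S_unit pM.
have EX x i : x \in E -> x ^+ i \in E.
  by move=> Ex; elim: i => [|i IHi]; rewrite ?expr0 // exprS EM.
exists a => //; exists q => //; split=> x Ex.
  by rewrite -phi0 ?EB ?EX // phiB phiX // Sq ?subrr //; apply/SP; exists x.
have [|nz] := boolP (phi x == 0); first by rewrite phi0 //; left.
right; have [|i Di] := Sa (phi x) _ nz; first by apply/SP; exists x.
by exists i; rewrite -phi0 ?EB ?EX // phiB Di phiX // subrr.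
Qed.

End LocalMatrixAlgebra.

(** * Finite subfields *)

Lemma rmorphism_factor (F k K : fieldType) (i : {rmorphism F -> K})
    (j : {rmorphism k -> K}) :
    (forall x, exists y, i x = j y) ->
  exists l : {rmorphism F -> k}, forall x, j (l x) = i x.
Proof.
case/choice=> l lP.
have lB : zmod_morphism l.
  by move=> x y; apply: (fmorph_inj j); rewrite -lP !rmorphB /= !lP.
have lM : monoid_morphism l.
  split=> [|x y]; apply: (fmorph_inj j); rewrite -lP ?rmorph1 //.
  by rewrite !rmorphM /= !lP.
pose lz := GRing.isZmodMorphism.Build F k l lB.
pose lm := GRing.isMonoidMorphism.Build F k l lM.
pose lr : {rmorphism F -> k} := HB.pack l lz lm.
by exists lr => x; rewrite -[lr x]/(l x) lP.
Qed.

(** The solutions of x^q = x in K, for q a power of the characteristic. *)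
Section FrobeniusFixed.

Variables (K : fieldType) (p q : nat).
Hypotheses (pK : p \in [pchar K]) (q_gt1 : (1 < q)%N) (pq : p.-nat q).

Let pqK : [pchar K].-nat q.
Proof. by rewrite (eq_pnat _ (pcharf_eq pK)). Qed.

Definition frob_fixed : {pred K} := [pred x | x ^+ q == x].

Lemma frob_fixed_closed : divring_closed frob_fixed.
Proof.
split=> [|x y|x y]; rewrite !inE ?expr1n //.
  by move=> /eqP fx /eqP fy; rewrite exprDn_pchar // exprNn_pchar // fx fy.
by move=> /eqP fx /eqP fy; rewrite expr_div_n fx fy.
Qed.

HB.instance Definition _ := GRing.isDivringClosed.Build K frob_fixed frob_fixed_closed.

Record frob_field := FrobField {frob_val :> K; _ : frob_val \in frob_fixed}.
HB.instance Definition _ := [isSub for frob_val].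
HB.instance Definition _ := [Choice of frob_field by <:].
HB.instance Definition _ := [SubChoice_isSubComUnitRing of frob_field by <:].
HB.instance Definition _ := [SubComUnitRing_isSubIntegralDomain of frob_field by <:].
HB.instance Definition _ := [SubIntegralDomain_isSubField of frob_field by <:].

(** There are at most q solutions, so a duplicate-free list of maximal length
    contains all of them. *)
Lemma frob_field_enum : exists e : seq frob_field, forall x, x \in e.
Proof.
pose P n : bool := asbool (exists e : seq frob_field, uniq e /\ size e = n).
have P0 : exists n, P n by exists 0%N; apply/asboolP; exists [::].
have Pq n : P n -> (n <= q)%N.
  case/asboolP=> e [ue <-]; rewrite -(size_map frob_val).
  have sXq : size ('X^q - 'X : {poly K})%R = q.+1.
    by rewrite size_polyDl ?size_polyXn // size_polyN size_polyX.
  rewrite -ltnS -sXq; apply: max_poly_roots.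
  - by rewrite -size_poly_eq0 sXq.
  - apply/allP=> _ /mapP[x _ ->]; have := valP x; rewrite inE => /eqP fx.
    by rewrite rootE !hornerE fx subrr.
  by rewrite map_inj_uniq //; apply: val_inj.
case: (ex_maxnP P0 Pq) => n /asboolP[e [ue <-]] maxe; exists e => x.
apply/negPn/negP => nex; have /maxe : P (size e).+1.
  by apply/asboolP; exists (x :: e); rewrite /= nex.
by rewrite ltnn.
Qed.

Lemma finite_subfield :
  exists (k : finFieldType) (j : {rmorphism k -> K}),
    forall x, x ^+ q = x -> exists y, x = j y.
Proof.
have [e eP] := frob_field_enum.
pose f (x : frob_field) : 'I_(size e).+1 := inord (index x e).
pose g (i : 'I_(size e).+1) : frob_field := nth 0 e i.
have fK : cancel f g.
  by move=> x; rewrite /g inordK ?nth_index // ltnS ltnW // index_mem.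
pose cL := CanIsCountable fK.
pose cT : countType := HB.pack frob_field cL.
have uenum : Finite.axiom (undup e : seq cT).
  by apply: Finite.uniq_enumP => [|x]; rewrite ?undup_uniq // mem_undup eP.
pose fL := isFinite.Build cT uenum.
pose k : finFieldType := HB.pack frob_field cL fL.
exists k, (\val : {rmorphism frob_field -> K}) => x /eqP fx.
by exists (FrobField fx).
Qed.

End FrobeniusFixed.

(** Let h be g with its coefficients raised to the power q. Modulo g, where
    X^q = X, the polynomial h is g^q = 0; as h and g are monic of the same degree,
    they are equal. *)
Lemma frob_dvd_coef (K : fieldType) p q (g : {poly K}) :
    p \in [pchar K] -> (1 < q)%N -> p.-nat q -> g \is monic ->
    g %| 'X^q - 'X -> forall i, g`_i ^+ q = g`_i.
Proof.
move=> pK q1 pq mg gX.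
have q0 : (0 < q)%N by apply: ltnW.
have pqK : [pchar K].-nat q by rewrite (eq_pnat _ (pcharf_eq pK)).
have pqP : [pchar {poly K}].-nat q by rewrite (eq_pnat _ (pchar_poly K)).
pose h := \poly_(i < size g) (g`_i ^+ q).
have Xmod i : g %| 'X^(i * q) - 'X^i.
  by rewrite mulnC exprM; have := subrXX ('X^q) ('X : {poly K}) i; move=> ->; apply: dvdp_mulr.
have gq : g ^+ q = \sum_(i < size g) g`_i ^+ q *: 'X^(i * q).
  rewrite -{1}[g]coefK poly_def.
  rewrite (big_morph (fun f : {poly K} => f ^+ q) (id1 := 0) (op1 := +%R)).
  - by apply: eq_bigr => i _; rewrite exprZn -exprM.
  - by move=> x y; rewrite exprDn_pchar.
  by rewrite expr0n gtn_eqF.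
have gh : g %| h.
  have : g %| g ^+ q - h.
    rewrite gq /h poly_def -sumrB; apply: (big_ind (fun f => g %| f)) => [|f1 f2|i _].
    - exact: dvdp0.
    - exact: dvdp_add.
    by rewrite -scalerBr -mul_polyC dvdp_mull ?Xmod.
  by rewrite dvdp_subr // dvdp_exp.
have g0 := monic_neq0 mg.
have sg : (0 < size g)%N by rewrite size_poly_gt0.
have hg : h = g.
  apply/eqP; rewrite -subr_eq0; apply: contraTT gh => hg0.
  have : ~~ (g %| h - g).
    rewrite gtNdvdp // -(prednK sg) ltnS; apply/leq_sizeP => i le_i.
    rewrite coefB coef_poly; case: ltnP => [lt_i|le_gi]; last first.
      by rewrite [g`_i]nth_default ?subr0.
    have -> : i = (size g).-1 by apply/eqP; rewrite eqn_leq le_i -ltnS prednK ?lt_i.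
    by rewrite -lead_coefE (monicP mg) expr1n subrr.
  by rewrite dvdp_subl.
move=> i; have [lt_i | le_i] := ltnP i (size g); last first.
  by rewrite nth_default // expr0n gtn_eqF.
by rewrite -[in RHS]hg coef_poly lt_i.
Qed.

Lemma separable_frob (K : fieldType) p q :
    p \in [pchar K] -> (1 < q)%N -> p.-nat q ->
  separable_poly ('X^q - 'X : {poly K}).
Proof.
move=> pK q1 pq; rewrite separable_poly.unlock derivB derivXn derivX.
have -> : 'X^(q.-1) *+ q = 0 :> {poly K}.
  have /dvdnP[m ->] : (p %| q)%N.
    have [p_pr _] := andP pK; have [q' Eq] : exists q', q = (p ^ q')%N.
      by have /p_natP[m] := pq; exists m.
    by move: q1; rewrite Eq; case: q' {Eq} => // m _; rewrite expnS dvdn_mulr.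
  by rewrite mulrnA -mulr_natr -polyC_natr (pcharf0 pK) mulr0.
have -> : 0 - 1 = (-1) *: 1 :> {poly K} by rewrite scaleN1r sub0r.
by rewrite coprimepZr ?oppr_eq0 ?oner_eq0 ?coprimep1.
Qed.

(** * Descent of indecomposable modules to finite fields *)

Lemma reducible_proper_divisor (F : fieldType) (P : {poly F}) :
    (1 < size P)%N -> ~ irreducible_poly P ->
  exists g : {poly F}, [/\ (1 < size g)%N, (size g < size P)%N & g %| P].
Proof.
move=> sP redP; have P0 : P != 0 by rewrite -size_poly_gt0 ltnW.
have [g [sg gP ngP]] :
    exists g : {poly F}, [/\ size g != 1%N, g %| P & ~~ (g %= P)].
  apply: contrapT => no; apply: redP; split=> // g sg gP.
  by apply/negPn/negP=> ngP; apply: no; exists g.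
have g0 : g != 0 by apply: contraTneq gP => ->; rewrite dvd0p.
exists g; split=> //; first by rewrite ltn_neqAle eq_sym sg size_poly_gt0.
rewrite ltn_neqAle dvdp_leq // andbT.
by apply: contra ngP; rewrite dvdp_size_eqp.
Qed.

Lemma irreducible_factor (F : fieldType) (P : {poly F}) :
  (1 < size P)%N -> exists2 f, irreducible_poly f & f %| P.
Proof.
have [n] := ubnP (size P); elim: n P => // n IHn P /ltnSE sPn sP.
have [irrP | redP] := pselect (irreducible_poly P); first by exists P.
have [g [sg ltgP gP]] := reducible_proper_divisor sP redP.
have [f irrf fg] := IHn g (leq_trans ltgP sPn) sg.
by exists f => //; apply: dvdp_trans gP.
Qed.

Section EndomorphismRing.

Variables (gT : finGroupType) (G : {group gT}).

Lemma rsim_map_dadd (k K : fieldType) (j : {rmorphism k -> K}) n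
    (rN : mx_representation k G n) (r1 r2 : representation k G) :
  mx_rsim rN (dadd_grepr r1 r2) ->
  mx_rsim (map_repr j rN)
    (dadd_grepr (Representation (map_repr j r1)) (Representation (map_repr j r2))).
Proof.
case/rsim_mutual_inverse=> A [B [AB BA rA _]].
apply: (@mutual_inverse_rsim _ _ _ _ _ _ _ (map_mx j A) (map_mx j B)).
- by rewrite -map_mxM AB map_mx1.
- move=> x Gx; rewrite /= /map_repr_mx -map_mxM rA // map_mxM /=.
  by rewrite map_block_mx !map_mx0.
by rewrite -map_mxM BA map_mx1.
Qed.

Section Indecomposable.

Variables (k : finFieldType) (K : fieldType) (j : {rmorphism k -> K}).
Variables (d : nat) (rN : mx_representation k G d.+1).
Hypothesis indN : indecomposable rN.

Definition endo : {pred 'M[k]_d.+1} := [pred g | centgmx rN g].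

Lemma endoP g :
  reflect {in G, forall x, g *m rN x = rN x *m g} (g \in endo).
Proof. exact: centgmxP. Qed.

Lemma endo1 : 1 \in endo.
Proof. by apply/endoP=> x _; rewrite mul1mx mulmx1. Qed.

Lemma endoB : {in endo &, forall a b, a - b \in endo}.
Proof.
move=> a b /endoP ca /endoP cb; apply/endoP=> x Gx.
by rewrite mulmxBl mulmxBr ca ?cb.
Qed.

Lemma endoM : {in endo &, forall a b, a * b \in endo}.
Proof.
move=> a b /endoP ca /endoP cb; apply/endoP=> x Gx.
by rewrite -[a * b]/(a *m b) -mulmxA cb // mulmxA ca // mulmxA.
Qed.

Lemma endoV : {in endo, forall a, a^-1 \in endo}.
Proof.
move=> a Ea; have [ua | /invr_out-> //] := boolP (a \is a GRing.unit).
apply/endoP=> x Gx; apply: (canLR (mulKmx ua)).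
by rewrite mulmxA (endoP _ Ea) // mulmxK.
Qed.

Lemma endoZ c a : a \in endo -> c *: a \in endo.
Proof.
by move/endoP=> ca; apply/endoP=> x Gx; rewrite -scalemxAl ca // scalemxAr.
Qed.

Lemma endo_local : {in endo, forall a, a \in unitmx \/ 1 - a \in unitmx}.
Proof. by move=> a /(indecomposable_local indN). Qed.

(** The endomorphisms solve a linear system over k, whose solutions over K are
    spanned by those over k. *)
Lemma endo_kspan X : centgmx (map_repr j rN) X -> kspan j endo X.
Proof.
rewrite -memmx_cent_envelop -map_enveloping_algebra_mx -map_cent_mx.
case/submxP=> w /(congr1 vec_mx); rewrite mxvecK => ->.
rewrite mulmx_sum_row linear_sum /=.
apply: (big_ind (kspan j endo)) => [||i _]; [exact: kspan0 | exact: kspanD | ].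
rewrite linearZ /= -map_row -map_vec_mx; apply/kspanZ/kspan_map.
rewrite inE -memmx_cent_envelop vec_mxK; exact: row_sub.
Qed.

Local Notation J := (nonunit endo).

Let JE a : a \in J -> a \in endo. Proof. by case/andP. Qed.

Lemma endo_nonunit_nilpotent a : a \in J -> a ^+ d.+1 = 0.
Proof.
by case/andP=> Ea /negPf ua; case: (indecomposable_fitting indN Ea); rewrite ?ua.
Qed.

Lemma endo_horner a f : a \in endo -> horner_mx a f \in endo.
Proof.
move/endoP=> Ea; apply/endoP=> x Gx; symmetry; apply: comm_mx_horner.
by rewrite /comm_mx Ea.
Qed.

(** The powers of a span End(N) modulo J, so K (x) End(N) modulo the nilpotent
    ideal K (x) J is a quotient of K[X], in which f is 0. Writing the idempotent
    as e = H(a) modulo this ideal, f divides H (H - 1), hence H or H - 1, and e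
    or 1 - e is nilpotent. *)
Lemma idempotent_trivial a (f : {poly k}) (e : 'M[K]_d.+1) :
    a \in endo ->
    {in endo, forall x, x \in J \/ exists i, x - a ^+ i \in J} ->
    horner_mx a f \in J -> irreducible_poly (map_poly j f) ->
    centgmx (map_repr j rN) e -> e *m e = e ->
  e = 0 \/ e = 1.
Proof.
move=> Ea gen_a Jf irrf ce ee; set aK := map_mx j a.
have JM x y : x \in J -> y \in endo -> x * y \in J.
  by move=> Jx Ey; apply: (nonunitMr endoM).
have MJ x y : x \in endo -> y \in J -> x * y \in J.
  by move=> Jx Ey; apply: (nonunitMl endoM).
have nilJ X : kspan j J X -> X ^+ d.+1 = 0.
  apply: (nonunit_kspan_nilpotent endo1 endoB endoM endoV endoZ endo_local).
have hornE (H : {poly K}) : kspan j endo (horner_mx aK H).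
  apply: kspan_horner => [|x Ex]; [exact: endo1 | exact: endoM].
have subE X : kspan j J X -> kspan j endo X.
  apply: (kspan_ind (Q := kspan j endo)) => [||c x Jx].
  - exact: kspan0.
  - exact: kspanD.
  by apply/kspanZ/kspan_map/JE.
have [H [C JC De]] : exists H, exists2 C, kspan j J C & e = horner_mx aK H + C.
  apply: (kspan_ind (Q := fun X => exists H, exists2 C, kspan j J C & X = horner_mx aK H + C)
     _ _ _ (endo_kspan ce)) => [|_ _ [H1 [C1 J1 ->]] [H2 [C2 J2 ->]]|c x Ex].
  - by exists 0, 0; [exact: kspan0 | rewrite rmorph0 addr0].
  - exists (H1 + H2), (C1 + C2); first exact: kspanD.
    by rewrite rmorphD /= addrACA.
  have [Jx | [i Jx]] := gen_a x Ex.
    exists 0, (c *: map_mx j x); first by apply/kspanZ/kspan_map.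
    by rewrite rmorph0 add0r.
  exists (c *: 'X^i), (c *: map_mx j (x - a ^+ i)); first by apply/kspanZ/kspan_map.
  rewrite horner_mxZ rmorphXn /= horner_mx_X -scalerDr map_mxB.
  by rewrite -[map_mx j (a ^+ i)]/(map_mx j _) rmorphXn /= addrC subrK.
have JH : kspan j J (horner_mx aK (H * (H - 1))).
  rewrite mulrBr mulr1 rmorphB rmorphM /=; set h := horner_mx aK H.
  have -> : h * h - h = C - (h * C + (C * h + C * C)).
    have : e * e = e by exact: ee.
    rewrite De -/h mulrDl !mulrDr -addrA => /(canRL (addrK _)) ->.
    by rewrite addrAC (addrC h) addrK.
  have Eh := hornE H; have EC := subE _ JC.
  apply: kspanD => //; apply: kspanN; apply: kspanD; first exact: kspanM Eh JC.
  by apply: kspanD; [apply: kspanM JC Eh | apply: kspanM JC EC].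
have JfK : kspan j J (horner_mx aK (map_poly j f)).
  by rewrite -map_horner_mx; apply: kspan_map.
have fdvdJ H' : map_poly j f %| H' -> kspan j J (horner_mx aK H').
  by move=> /dvdpP[u ->]; rewrite rmorphM /=; apply: kspanM (hornE u) JfK.
have f_dvd : (map_poly j f %| H) || (map_poly j f %| H - 1).
  have : map_poly j f %| H * (H - 1).
    apply/negPn; rewrite -irreducible_poly_coprime //; apply/negP.
    case/Bezout_eq1_coprimepP=> -[u v] /= /(congr1 (horner_mx aK)).
    rewrite rmorphD rmorph1 /= => uv.
    suff /nilJ/eqP : kspan j J 1 by rewrite expr1n oner_eq0.
    rewrite -uv; apply: kspanD; first by apply: fdvdJ; apply: dvdp_mulIr.
    by rewrite rmorphM /=; apply: kspanM (hornE v) JH.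
  have [// | nfH] := boolP (map_poly j f %| H).
  by rewrite Gauss_dvdpr // irreducible_poly_coprime.
have idem_nil (x : 'M[K]_d.+1) : x * x = x -> kspan j J x -> x = 0.
  have xX m : x * x = x -> x ^+ m.+1 = x.
    by move=> xx; elim: m => [|m IHm]; rewrite ?expr1 // exprS IHm xx.
  by move=> xx /nilJ; rewrite xX.
case/orP: f_dvd => /fdvdJ JH'; [left | right].
  by apply: idem_nil => //; rewrite De; apply: kspanD.
apply/eqP; rewrite -subr_eq0 -oppr_eq0 opprB; apply/eqP; apply: idem_nil.
  have eee : e * e = e by exact: ee.
  by rewrite mulrBl mul1r mulrBr mulr1 eee subrr subr0.
rewrite -opprB; apply: kspanN; rewrite De addrAC; apply: kspanD => //.
by rewrite -(rmorph1 (horner_mx aK)) -rmorphB.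
Qed.

End Indecomposable.

End EndomorphismRing.

Section Descent.

Variables (gT : finGroupType) (G : {group gT}).

(** If N were indecomposable, g(a) or h(a) would be nilpotent; then f, hence also
    the other factor, would divide a power of g or of h, to which that factor
    is coprime. *)
Lemma coprime_factor_decomposable (k : fieldType) d
    (rN : mx_representation k G d.+1) (a : 'M[k]_d.+1) (f g h : {poly k}) m :
    centgmx rN a -> f = g * h -> coprimep g h ->
    (1 < size g)%N -> (1 < size h)%N -> f %| mxminpoly a ->
    horner_mx a f ^+ m = 0 ->
  ~ indecomposable rN.
Proof.
move=> ca Df cgh sg sh fP fm indN.
have cgm : coprimep (g ^+ m) (h ^+ m) by rewrite coprimep_expl // coprimep_expr.
have : horner_mx a (g ^+ m * h ^+ m) = 0.
  by rewrite -exprMn -Df rmorphXn.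
have not_dvd (u v : {poly k}) : coprimep u v -> (1 < size u)%N -> u %| f ->
    horner_mx a (v ^+ m) <> 0.
  move=> cuv su uf /mxminpoly_min/(dvdp_trans fP)/(dvdp_trans uf) uv.
  have := coprimep_dvdl uv (coprimep_expr m cuv).
  by rewrite coprimepp => /eqP su1; rewrite su1 in su.
have gf : g %| f by rewrite Df dvdp_mulIl.
have hf : h %| f by rewrite Df dvdp_mulIr.
case/(indecomposable_coprime indN ca cgm); last exact: (not_dvd g h).
by apply: (not_dvd h g); rewrite // coprimep_sym.
Qed.

(** The induction on the degree of N leaves two ways out: N decomposes, possibly
    after enlarging the finite field, and one of its two parts takes over; or
    M is K (x) N. *)
Lemma finite_descent p (K : fieldType) n (rM : mx_representation K G n) :
    p \in [pchar K] -> indecomposable rM ->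
  forall (k : finFieldType) (j : {rmorphism k -> K}) d
     (rN : mx_representation k G d),
    summand rM (map_repr j rN) ->
  exists (k' : finFieldType) (j' : {rmorphism k' -> K}), defined_over j' rM.
Proof.
move=> pK indM k j d; have [m] := ubnP d; elim: m => // m IHm in k j d *.
move=> /ltnSE le_dm rN MN.
have dec (k' : finFieldType) (j' : {rmorphism k' -> K}) (rN' : mx_representation k' G d) :
    summand rM (map_repr j' rN') -> ~ indecomposable rN' ->
  exists (k' : finFieldType) (j' : {rmorphism k' -> K}), defined_over j' rM.
  move=> MN' decN'; have d_gt0 : (0 < d)%N.
    by have [n_gt0 _] := indM; apply: leq_trans (summand_leq MN').
  have [r1 [r2 [lt1 lt2 sim]]] := decomposableP d_gt0 decN'.
  have := summand_trans MN' (rsim_summand (rsim_map_dadd j' sim)).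
  by case/(indecomposable_summand_dadd indM); apply: IHm; apply: leq_trans le_dm.
have [indN | /(dec _ _ _ MN) //] := pselect (indecomposable rN).
have pk : p \in [pchar k] by rewrite -(fmorph_pchar j).
case: d => [|d] in rN MN indN dec le_dm *; first by case: indN.
have [a Ea [q /andP[q1 pq] [Eq gen_a]]] := residue_field_generator
  (endo1 rN) (@endoB _ _ _ _ rN) (@endoM _ _ _ _ rN) (@endoV _ _ _ _ rN)
  (@endoZ _ _ _ _ rN) (endo_local indN) pk.
pose P := mxminpoly a.
have sP : (1 < size P)%N by rewrite size_mxminpoly ltnS mxminpoly_nonconstant.
have [f irrf fP] := irreducible_factor sP.
have P0 : P != 0 by rewrite -size_poly_gt0 ltnW.
have f0 := irredp_neq0 irrf.
have Jf : horner_mx a f \in nonunit (endo rN).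
  rewrite inE endo_horner //=; apply/negP=> uf.
  case/dvdpP: fP => r Dr.
  have : horner_mx a P = 0 by exact: mx_root_minpoly.
  rewrite Dr mulrC rmorphM /= => /(congr1 (mulmx (invmx (horner_mx a f)))).
  rewrite mulmx0 -[horner_mx a f * _]/(_ *m _) mulKmx // => /mxminpoly_min.
  have r0 : r != 0 by apply: contraNneq P0 => r0; rewrite Dr r0 mul0r.
  move/(dvdp_leq r0); rewrite -/P Dr size_mul // -ltnS prednK; last first.
    by rewrite addn_gt0 size_poly_gt0 r0.
  have [sf _] := irrf.
  by rewrite -addn1 leq_add2l leqNgt sf.
have fm : horner_mx a f ^+ d.+1 = 0 by apply: endo_nonunit_nilpotent indN _ Jf.
have fX : f %| 'X^q - 'X.
  have : P %| ('X^q - 'X) ^+ d.+1.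
    apply: mxminpoly_min; rewrite rmorphXn rmorphB rmorphXn /= horner_mx_X.
    by apply: (endo_nonunit_nilpotent indN); apply: Eq.
  move/(dvdp_trans fP); apply: contraLR; rewrite -!irreducible_poly_coprime //.
  exact: coprimep_expr.
have [A [B [AB rA rB]]] := MN.
(* If f is irreducible over K, the projection BA of K (x) N onto M is 1; if not,
   N decomposes over the finite subfield k' = {x | x^q = x} of K. *)
have [irrK | redK] := pselect (irreducible_poly (map_poly j f)).
  have cBA : centgmx (map_repr j rN) (B *m A).
    by apply/intertwines_cent; apply: intertwinesM rB rA.
  have BAA : (B *m A) *m (B *m A) = B *m A by rewrite mulmxA -(mulmxA B) AB mulmx1.
  have [BA0 | BA1] := idempotent_trivial indN Ea gen_a Jf irrK cBA BAA.
    have [n_gt0 _] := indM.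
    case: n n_gt0 => // n' _ in rM MN indM A B AB rA rB cBA BAA BA0 dec IHm *.
    have := congr1 (mulmx^~ B \o mulmx A) BA0.
    rewrite /= mulmx0 mul0mx mulmxA AB mul1mx AB => /eqP.
    by rewrite (oner_eq0 ('M[K]_n'.+1)).
  by exists k, j, d.+1, rN; apply: mutual_inverse_rsim AB rA BA1.
have sfK : size (map_poly j f) = size f by rewrite size_map_poly.
have [sf _] := irrf.
have [||g [sg ltg gf]] := @reducible_proper_divisor _ (map_poly j f).
- by rewrite sfK.
- exact: redK.
have [k' [j' j'P]] := finite_subfield pK q1 pq.
have g0 : g != 0 by rewrite -size_poly_gt0 ltnW.
pose g1 := (lead_coef g)^-1 *: g.
have lg : (lead_coef g)^-1 != 0 by rewrite invr_eq0 lead_coef_eq0.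
have mg1 : g1 \is monic by rewrite monicE lead_coefZ mulVf // lead_coef_eq0.
have g1f : g1 %| map_poly j f by rewrite dvdpZl.
have fXK : map_poly j f %| 'X^q - 'X.
  have <- : map_poly j ('X^q - 'X) = 'X^q - 'X by rewrite rmorphB /= map_polyXn map_polyX.
  by rewrite dvdp_map.
have /choice[c cP] i : exists y, g1`_i = j' y.
  by apply/j'P/(frob_dvd_coef pK q1 pq mg1 (dvdp_trans g1f fXK)).
pose g' := \poly_(i < size g1) c i.
have Dg1 : g1 = map_poly j' g'.
  apply/polyP=> i; rewrite coef_map coef_poly; case: ltnP => [_ | le_i]; first exact: cP.
  by rewrite nth_default //; exact: esym (rmorph0 j').
(* k lies in k': the scalar x^q - x belongs to J, so it is not invertible. *)
have [l lP] : exists l : {rmorphism k -> k'}, forall x, j' (l x) = j x.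
  apply: rmorphism_factor => x; apply: j'P; rewrite -rmorphXn; congr (j _).
  have := Eq _ (endoZ x (endo1 rN)).
  rewrite exprZn expr1n -scalerBl => /andP[_]; rewrite scalemx1 unitmxE det_scalar.
  by rewrite unitfE expf_eq0 negbK /= subr_eq0 => /eqP.
pose f' := map_poly l f; pose a' := map_mx l a.
have Df' : map_poly j' f' = map_poly j f.
  by rewrite -map_poly_comp; apply: eq_map_poly.
have gf' : g' %| f' by rewrite -(dvdp_map j') -Dg1 Df'.
pose h' := f' %/ g'; have Dgh : f' = g' * h' by rewrite mulrC divpK.
have sg1 : size g' = size g by rewrite -(size_map_poly j') -Dg1 size_scale.
have sg' : (1 < size g')%N by rewrite sg1.
have sf' : size f' = size f by rewrite size_map_poly.
have ltgf : (size g' < size f')%N by rewrite sg1 sf' -sfK.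
have sh : (1 < size h')%N.
  have g'0 : g' != 0 by rewrite -size_poly_gt0 ltnW.
  by rewrite size_divp // ltn_subRL addn1 prednK // ltnW.
have fX' : f' %| 'X^q - 'X.
  by rewrite -(dvdp_map j') Df' rmorphB /= map_polyXn map_polyX.
have pk' : p \in [pchar k'] by rewrite -(fmorph_pchar j').
apply: (dec k' j' (map_repr l rN)).
  apply: summand_trans MN _; apply/rsim_summand/eq_rsim => x Gx.
  rewrite /= /map_repr_mx -map_mx_comp.
  by apply: eq_map_mx => y; rewrite /= lP.
apply: (@coprime_factor_decomposable _ _ _ a' f' _ _ d.+1 _ Dgh) => //.
- apply/centgmxP=> x Gx; rewrite /= /map_repr_mx -!map_mxM.
  by rewrite (centgmxP _ x Gx).
- by apply: (separable_coprime (separable_frob pk' q1 pq)); rewrite -Dgh.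
- by rewrite mxminpoly_map dvdp_map.
by rewrite -map_horner_mx -rmorphXn fm rmorph0.
Qed.

End Descent.

(** * Essential dimension zero for cyclic Sylow subgroups *)

Section AlgebraicClosure.

Variables (F K : fieldType) (iota : {rmorphism F -> K}).

Definition algebraic_elt : {pred K} := fun x => asbool (algebraicOver iota x).

Lemma algebraic_eltP x : reflect (algebraicOver iota x) (x \in algebraic_elt).
Proof. exact: asboolP. Qed.

Lemma algebraic_elt_closed : divring_closed algebraic_elt.
Proof.
split=> [|x y|x y].
- exact/algebraic_eltP/algebraic1.
- by move=> /algebraic_eltP ax /algebraic_eltP ay; apply/algebraic_eltP/algebraic_sub.
- move=> /algebraic_eltP ax /algebraic_eltP ay; apply/algebraic_eltP.
  exact: algebraic_div.
Qed.

HB.instance Definition _ :=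
  GRing.isDivringClosed.Build K algebraic_elt algebraic_elt_closed.

Record algebraic_field :=
  AlgebraicField {alg_val :> K; _ : alg_val \in algebraic_elt}.
HB.instance Definition _ := [isSub for alg_val].
HB.instance Definition _ := [Choice of algebraic_field by <:].
HB.instance Definition _ := [SubChoice_isSubComUnitRing of algebraic_field by <:].
HB.instance Definition _ := [SubComUnitRing_isSubIntegralDomain of algebraic_field by <:].
HB.instance Definition _ := [SubIntegralDomain_isSubField of algebraic_field by <:].

Lemma relative_algebraic_closure :
  exists (K0 : fieldType) (i : {rmorphism F -> K0}) (j : {rmorphism K0 -> K}),
    [/\ forall a, j (i a) = iota a,
        forall x, algebraicOver i x
      & forall x, algebraicOver iota x -> exists y, x = j y].
Proof.
pose j : {rmorphism algebraic_field -> K} := \val.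
have jP x : algebraicOver iota x -> exists y, x = j y.
  by move=> ax; exists (AlgebraicField (introT (algebraic_eltP x) ax)).
have [i iP] : exists i : {rmorphism F -> algebraic_field}, forall x, j (i x) = iota x.
  by apply: rmorphism_factor => x; apply/jP/algebraic_id.
exists algebraic_field, i, j; split=> // x.
have /algebraic_eltP[q q0 qx] := valP x; exists q => //.
rewrite -(fmorph_root j) -map_poly_comp.
by rewrite (_ : map_poly _ q = map_poly iota q) //; apply: eq_map_poly.
Qed.

End AlgebraicClosure.

Lemma trdeg_ge0 (R : realType) (F L : fieldType) (f : {rmorphism F -> L}) :
  (0 <= trdeg R f)%E.
Proof.
apply: ereal_sup_ubound; exists 0%N => //.
exists (fun=> 0) => q.
have Dq : q = mpolyC 0 (mcoeff (mnm0) q).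
  apply/mpolyP=> m; rewrite mcoeffC; have -> : m = mnm0 by apply/mnmP=> -[].
  by rewrite eqxx mulr1.
rewrite Dq mmapC => /eqP; rewrite fmorph_eq0 => /eqP q0.
apply/mpolyP=> m; have -> : m = mnm0 by apply/mnmP=> -[].
by rewrite q0 mpolyC0.
Qed.

(** An equation for x_0 over F contradicts the independence of x_0, ..., x_n. *)
Lemma trdeg_algebraic (R : realType) (F L : fieldType) (f : {rmorphism F -> L}) :
  (forall x, algebraicOver f x) -> trdeg R f = 0%E.
Proof.
move=> alg; apply/eqP; rewrite eq_le trdeg_ge0 andbT.
apply: ge_ereal_sup => _ [n [x indx] <-].
case: n x indx => [|n] x indx; first by rewrite lee_fin.
have [q q0 /rootP qx] := alg (x ord0).
pose Y : mpoly n.+1 F := mpolyX _ (mnm1 ord0).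
pose Q : mpoly n.+1 F := \sum_(k < size q) q`_k *: Y ^+ k.
have : Q = 0.
  apply: indx; rewrite /Q raddf_sum /= -[RHS]qx horner_coef size_map_poly.
  apply: eq_bigr => k _; rewrite mmapZ rmorphXn /= /Y mmapX mmap1U.
  by rewrite coef_map.
move=> Q0; case/eqP: q0; apply/polyP=> k; rewrite coef0.
have [lt_k | le_k] := ltnP k (size q); last by rewrite nth_default.
have := congr1 (mcoeff (mnm_muln (mnm1 ord0) k)) Q0.
rewrite mcoeff0 /Q raddf_sum (bigD1 (Ordinal lt_k)) //= mcoeffZ mcoeffXn eqxx mulr1.
rewrite big1 ?addr0 // => l; rewrite -val_eqE /= => nlk.
rewrite mcoeffZ mcoeffXn; case: eqP => [|_]; last by rewrite mulr0.
move/(congr1 (fun m : multinom _ => m ord0)).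
rewrite !mulmnE mnm1E eqxx !mul1n => lk; by rewrite lk eqxx in nlk.
Qed.

(** With q the cardinal of k, j x is a root of X^q - X, a polynomial over F. *)
Lemma finite_field_algebraic (F K : fieldType) (iota : {rmorphism F -> K})
    (k : finFieldType) (j : {rmorphism k -> K}) x :
  algebraicOver iota (j x).
Proof.
exists ('X^#|k| - 'X).
  rewrite -size_poly_eq0 size_polyDl ?size_polyXn // size_polyN size_polyX.
  by rewrite ltnS finNzRing_gt1.
rewrite rmorphB /= map_polyXn map_polyX rootE !hornerE -rmorphXn expf_card subrr.
by [].
Qed.

(** The finite field over which an indecomposable summand is defined depends on
    the summand, but all of them lie in the algebraic closure of F in K. *)
Lemma cyclic_sylow_defined_algebraic p (gT : finGroupType) (G P : {group gT})
    (F K : fieldType) (iota : {rmorphism F -> K}) n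
    (rM : mx_representation K G n) :
    p \in [pchar K] -> p.-Sylow(G)%g P -> cyclic P ->
  exists (K0 : fieldType) (i : {rmorphism F -> K0}) (j : {rmorphism K0 -> K}),
    [/\ forall a, j (i a) = iota a, forall x, algebraicOver i x
      & defined_over j rM].
Proof.
move=> pK sylP cycP; have [K0 [i [j [ij algi jP]]]] := relative_algebraic_closure iota.
exists K0, i, j; split=> //; move: n rM; apply: defined_over_indecomposable => n rM indM.
have /andP[p_pr _] := pK; have sPG := pHall_sub sylP.
have [k [jk _]] := finite_subfield pK (prime_gt1 p_pr) (pnat_id p_pr).
have [d [r0 sim]] := defined_over_cyclic jk (subg_repr rM sPG) pK (pHall_pgroup sylP) cycP.
have idx : #|G : P|%g%:R != 0 :> K.
  by have /and3P[_ _] := sylP; rewrite p'natE // (dvdn_pcharf pK).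
have {}sim := summand_induced idx (rsim_summand sim).
have MN : summand rM (map_repr jk (induced_repr sPG r0)).
  apply: summand_trans sim _; apply/rsim_summand/eq_rsim => x Gx.
  by rewrite map_induced.
have [k' [j' [m [r' sim']]]] := finite_descent pK indM MN.
have [l lP] : exists l : {rmorphism k' -> K0}, forall x, j (l x) = j' x.
  by apply: rmorphism_factor => x; apply/jP/finite_field_algebraic.
exists m, (map_repr l r'); apply: mx_rsim_trans sim' (eq_rsim _) => x Gx.
rewrite /= /map_repr_mx -map_mx_comp.
by apply: eq_map_mx => y; rewrite /= lP.
Qed.

Lemma ed_ge0 (R : realType) (F K : fieldType) (iota : {rmorphism F -> K})
    (gT : finGroupType) (G : {group gT}) n (rM : mx_representation K G n) :
  (0 <= ed R iota rM)%E.
Proof. by apply: le_ereal_inf_tmp => _ [K0 [i [j [_ ->]]]]; apply: trdeg_ge0. Qed.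

Lemma ed_Mod_ge (R : realType) (F K : fieldType) (iota : {rmorphism F -> K})
    (gT : finGroupType) (G : {group gT}) n (rM : mx_representation K G n) :
  (ed R iota rM <= ed_Mod R F G)%E.
Proof. by apply: ereal_sup_ubound; exists K, iota, n, rM. Qed.

Lemma ed_Mod_cyclic (R : realType) p (F : fieldType) (gT : finGroupType)
    (G : {group gT}) :
    p \in [pchar F] -> (forall P : {group gT}, p.-Sylow(G)%g P -> cyclic P) ->
  ed_Mod R F G = 0%E.
Proof.
move=> pF cycS; have [P sylP] := Sylow_exists p G.
apply/eqP; rewrite eq_le; apply/andP; split; last first.
  apply: le_trans (ed_Mod_ge R (idfun : {rmorphism F -> F}) (@grepr0 F gT G)).
  exact: ed_ge0.
apply: ge_ereal_sup => _ [K [iota [n [rM ->]]]].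
have pK : p \in [pchar K] by rewrite (fmorph_pchar iota).
have [K0 [i [j [ij algi defM]]]] :=
  cyclic_sylow_defined_algebraic iota rM pK sylP (cycS P sylP).
apply: ereal_inf_lbound; exists K0, i, j; split; last by rewrite trdeg_algebraic.
by split.
Qed.

(** * Leading monomials and transcendence degree *)

Section LeadingMonomials.

Lemma fraction_repr (R : idomainType) (z : {fraction R}) :
  exists P Q : R, Q != 0 /\ z * FracField.tofrac Q = FracField.tofrac P.
Proof.
exists (\n_(generic_quotient.repr z)), (\d_(generic_quotient.repr z)).
split; first exact: denom_ratioP.
rewrite -{1}[z]reprK; apply/eqP; rewrite !piE /FracField.equivf /FracField.mulf.
by rewrite !numden_Ratio ?mulf_neq0 ?oner_neq0 ?denom_ratioP // !mulr1 mulrC.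
Qed.

Lemma common_denominator (R : idomainType) (I : finType) (z : I -> {fraction R}) :
  exists (Q : R) (P : I -> R), Q != 0 /\
    forall i, z i * FracField.tofrac Q = FracField.tofrac (P i).
Proof.
have /choice[P /choice[D PD]] i := fraction_repr (z i).
exists (\prod_i D i), (fun i => P i * \prod_(l | l != i) D l); split.
  by apply/prodf_neq0 => i _; case: (PD i).
move=> i; rewrite (bigD1 i) //= !rmorphM /= mulrA.
by have [_ ->] := PD i.
Qed.

Variables (F : fieldType) (n : nat).
Local Notation Pn := (mpoly n F).
Local Notation frac := (@FracField.tofrac (mpoly n F)).

(** The largest of the leading monomials is not cancelled. The induction also
    needs that it is the leading monomial of the sum. *)
Lemma sum_neq0_mlead (I : eqType) (r : seq I) (f : I -> mpoly n F) :
    uniq r -> r != [::] -> {in r, forall i, f i != 0} ->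
    {in r &, injective (fun i => mlead (f i))} ->
  \sum_(i <- r) f i != 0.
Proof.
move=> ur r0 f0 injf.
suff [] : \sum_(i <- r) f i != 0 /\
    exists2 i, i \in r & mlead (\sum_(i <- r) f i) = mlead (f i) by [].
elim: r ur r0 f0 injf => //= x r IHr /andP[xr ur] _ f0 injf.
rewrite big_cons; have [-> | r0] := eqVneq r [::].
  rewrite big_nil addr0; split; first by apply: f0; rewrite mem_head.
  by exists x; rewrite ?mem_head.
have [||S0 [y yr Sy]] := IHr ur r0.
- by move=> i ir; apply: f0; rewrite inE ir orbT.
- by move=> i l ir lr; apply: injf; rewrite inE ?ir ?lr orbT.
set S := \sum_(i <- r) f i in S0 Sy *.
have xx : x \in x :: r by rewrite mem_head.
have yy : y \in x :: r by rewrite inE yr orbT.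
have ne : mlead (f x) != mlead S.
  by rewrite Sy; apply: contraNneq xr => /(injf _ _ xx yy) ->.
have neq0 (P Q : mpoly n F) : Q != 0 -> mlead (P + Q) = mlead Q ->
    mlead P != mlead Q -> P + Q != 0.
  move=> Q0 lQ; apply: contraNneq => PQ0.
  by rewrite (canRL (addrK _) PQ0) sub0r mleadN.
move: ne; case: ltgtP => // [lt | lt] _.
  have lS := mleadDr lt; split; last by exists y; rewrite ?lS.
  by apply: neq0 => //; rewrite lt_eqF.
have lS := mleadDl lt; split; last by exists x; rewrite ?lS.
by rewrite addrC; apply: neq0; rewrite ?f0 ?lt_eqF // addrC.
Qed.

Definition frac_const : {rmorphism F -> {fraction Pn}} := frac \o (@mpolyC n F).
Definition frac_var (i : 'I_n) : {fraction Pn} := frac (mpolyX F (mnm1 i)).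

Lemma frac_eq0 (P : Pn) : (frac P == 0) = (P == 0).
Proof. exact: tofrac_eq0. Qed.

Section AlgebraicSubfield.

Variables (K0 : fieldType) (i0 : {rmorphism F -> K0}).
Variable (j : {rmorphism K0 -> {fraction Pn}}).
Hypothesis ji0 : forall a, j (i0 a) = frac_const a.

(** Clear denominators in an equation for X_i with coefficients in K0. Two terms
    have the same leading monomial, and y is the quotient of the coefficients
    of these two terms. *)
Lemma algebraic_var_mlead (i : 'I_n) : algebraicOver j (frac_var i) ->
  exists (y : K0) (N : nat) (P Q : Pn),
    [/\ (0 < N)%N, P != 0, Q != 0, j y * frac Q = frac P
      & mlead P = mnm_add (mlead Q) (mnm_muln (mnm1 i) N)].
Proof.
move=> [q q0 /rootP qt].
have [D [A [D0 AD]]] := common_denominator (fun k : 'I_(size q) => j q`_k).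
pose X : Pn := mpolyX F (mnm1 i).
have sumA : \sum_k A k * X ^+ k = 0.
  apply/eqP; rewrite -frac_eq0 rmorph_sum /=; apply/eqP.
  transitivity ((map_poly j q).[frac_var i] * frac D); last by rewrite qt mul0r.
  rewrite horner_coef size_map_poly mulr_suml; apply: eq_bigr => k _.
  by rewrite rmorphM rmorphXn /= -AD coef_map mulrAC.
pose r := [seq k <- enum 'I_(size q) | A k != 0].
have mr k : (k \in r) = (A k != 0) by rewrite mem_filter mem_enum andbT.
have X0 : X != 0 by rewrite -msize_poly_eq0 msizeX.
have leadAX k : A k != 0 ->
    mlead (A k * X ^+ k) = mnm_add (mlead (A k)) (mnm_muln (mnm1 i) k).
  move=> Ak; rewrite mleadM ?expf_neq0 // /X mpolyXn mleadXm //.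
have Aj k : (A k == 0) = (q`_k == 0).
  by rewrite -frac_eq0 -AD mulf_eq0 frac_eq0 (negPf D0) orbF fmorph_eq0.
have [k [l [Ak Al lt_kl E]]] : exists k l : 'I_(size q),
    [/\ A k != 0, A l != 0, (k < l)%N & mlead (A k * X ^+ k) = mlead (A l * X ^+ l)].
  apply: contrapT => no.
  have ur : uniq r by rewrite filter_uniq // enum_uniq.
  have r0 : r != [::].
    have lt_q : ((size q).-1 < size q)%N by rewrite prednK // size_poly_gt0.
    apply: contraNneq q0 => r0; have := mr (Ordinal lt_q).
    by rewrite r0 in_nil Aj -lead_coefE => /esym/negPn; rewrite lead_coef_eq0.
  apply: (elimN eqP (sum_neq0_mlead (f := fun k : 'I_(size q) => A k * X ^+ k) ur r0 _ _)).
  - by move=> k; rewrite mr => Ak; rewrite mulf_neq0 ?expf_neq0.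
  - move=> k l; rewrite !mr => Ak Al E; apply: val_inj => /=.
    by case: (ltngtP k l) => // lt; case: no; [exists k, l | exists l, k].
  rewrite big_filter big_enum_cond /= big_mkcond -[RHS]sumA; apply: eq_bigr => k _.
  by case: eqP => // ->; rewrite mul0r.
have ql : j q`_l != 0 by rewrite fmorph_eq0 -Aj.
exists (q`_k / q`_l), (l - k)%N, (A k), (A l); split=> //.
- by rewrite subn_gt0.
- by rewrite -!AD fmorph_div mulrA divfK.
move: E; rewrite !leadAX // => /mnmP E; apply/mnmP=> x; have := E x.
rewrite !mnmDE !mulmnE => Ex; apply/eqP; rewrite -(eqn_add2r (mnm1 i x * k)) Ex -addnA.
by rewrite -mulnDr subnK // ltnW.
Qed.

(** The leading exponents of the y_i are positive multiples of the unit vectors,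
    so distinct monomials in the y_i have distinct leading exponents. *)
Lemma algebraic_vars_independent :
    (forall i, algebraicOver j (frac_var i)) ->
  exists y : 'I_n -> K0, algebraically_independent i0 y.
Proof.
move=> alg; have /choice[y yP] i := algebraic_var_mlead (alg i).
have /choice[N /choice[P /choice[Q NPQ]]] := yP.
exists y => q qy; apply: contrapT => /eqP q0.
have [N0 P0 Q0 yPQ leadP] : [/\ forall i, (0 < N i)%N, forall i, P i != 0,
    forall i, Q i != 0, forall i, j (y i) * frac (Q i) = frac (P i)
  & forall i, mlead (P i) = mnm_add (mlead (Q i)) (mnm_muln (mnm1 i) (N i))].
  by split=> i; case: (NPQ i).
(* Multiplying by the D-th powers of the denominators Q_i, where D bounds all
   exponents occurring in q, turns q(y) into a sum of polynomials. *)
pose D := msize q.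
pose f m : Pn := mcoeff m q *: \prod_i (P i ^+ (m i) * Q i ^+ (D - m i)).
have le_mD m i : m \in msupp q -> (m i <= D)%N.
  move=> /msize_mdeg_lt /ltnW; apply: leq_trans.
  by rewrite mdegE (bigD1 i) //= leq_addr.
have term0 m : \prod_i (P i ^+ (m i) * Q i ^+ (D - m i)) != 0.
  by apply/prodf_neq0=> i _; rewrite mulf_neq0 ?expf_neq0.
apply: (elimN eqP (sum_neq0_mlead (f := f) (msupp_uniq q) _ _ _)).
- by rewrite msupp_eq0.
- by move=> m mq; rewrite scaler_eq0 negb_or term0 -mcoeff_msupp mq.
- move=> m1 m2 m1q m2q; rewrite !mleadZ -?mcoeff_msupp //.
  rewrite !mlead_prod => [|i _ _|i _ _]; try by rewrite mulf_neq0 ?expf_neq0.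
  move=> /mnmP E; apply/mnmP=> l; have := E l; rewrite !mnm_sumE.
  have lead_l m i : m \in msupp q ->
      mlead (P i ^+ (m i) * Q i ^+ (D - m i)) l =
      (D * mlead (Q i) l + (i == l) * N i * m i)%N.
    move=> mq; rewrite mleadM ?expf_neq0 // !mleadX // leadP !(mnmDE, mulmnE) mnm1E.
    have Di := subnKC (le_mD m i mq).
    by rewrite mulnDl addnAC -mulnDr Di [(D * _)%N]mulnC.
  rewrite (eq_bigr _ (fun i _ => lead_l m1 i m1q)).
  rewrite (eq_bigr _ (fun i _ => lead_l m2 i m2q)) !big_split /=.
  move/eqP; rewrite eqn_add2l (bigD1 l) //= big1 => [|i /negPf->]; last by rewrite !mul0n.
  rewrite [X in _ == X](bigD1 l) //= big1 => [|i /negPf->]; last by rewrite !mul0n.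
  by rewrite eqxx !addn0 !mul1n eqn_pmul2l // => /eqP.
apply/eqP; rewrite -frac_eq0 rmorph_sum /=; apply/eqP.
transitivity (j (mmap i0 y q) * frac (\prod_i Q i ^+ D)); last first.
  by rewrite qy rmorph0 mul0r.
rewrite /mmap rmorph_sum mulr_suml; apply: eq_big_seq => m mq.
rewrite /f -mul_mpolyC rmorphM /= rmorphM /= ji0 -mulrA; congr (_ * _).
rewrite /mmap1 !rmorph_prod -big_split /=; apply: eq_bigr => i _.
rewrite rmorphM !rmorphXn /= -yPQ exprMn -mulrA -exprD.
by rewrite subnKC ?le_mD.
Qed.

End AlgebraicSubfield.

End LeadingMonomials.

(** * Unipotent modules with parameters and pencils of matrices *)

(** P modulo its Frattini subgroup is a vector space over F_p of dimension at
    least 2; al and be are two of its coordinates, seen in K. *)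
Lemma noncyclic_coordinates p (gT : finGroupType) (P : {group gT}) (K : fieldType) :
    p \in [pchar K] -> p.-group%g P -> ~~ cyclic P ->
  exists (al be : gT -> K) (a b : gT),
    [/\ {in P &, {morph al : x y / (x * y)%g >-> x + y}},
        {in P &, {morph be : x y / (x * y)%g >-> x + y}},
        (a \in P) && (b \in P),
        al a = 1 /\ al b = 0
      & be a = 0 /\ be b = 1].
Proof.
move=> pK pP ncP; have /andP[p_pr _] := pK.
have abE : p.-abelem%g (P / 'Phi(P))%G := Phi_quotient_abelem pP.
have ncE : ~~ cyclic (P / 'Phi(P))%G by apply: contra ncP => /Phi_quotient_cyclic.
have ntE : (P / 'Phi(P))%G :!=: 1%g by apply: contraNneq ncE => ->; apply: cyclic1.
have dimE : (1 < ('dim (P / 'Phi(P))%G))%N.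
  by rewrite (dim_abelemE abE ntE) ltnNge -(abelem_cyclic abE).
set E := (P / 'Phi(P))%G in abE ncE ntE dimE.
pose phi (z : 'F_p) : K := (z : nat)%:R.
have modp m : (m %% (Zp_trunc (pdiv p)).+2)%:R = m%:R :> K.
  by rewrite Fp_cast // {2}(divn_eq m p) natrD natrM (pcharf0 pK) mulr0 add0r.
have phiD : {morph phi : x y / x + y}.
  by move=> x y; rewrite /phi /= modp natrD.
pose v x := abelem_rV abE ntE (coset 'Phi(P) x).
have nPhi : (P \subset 'N('Phi(P)))%g := normal_norm (Phi_normal P).
have vM : {in P &, {morph v : x y / (x * y)%g >-> x + y}}.
  move=> x y Px Py; have Nx := subsetP nPhi x Px; have Ny := subsetP nPhi y Py.
  rewrite /v coset_morphM //.
  by rewrite abelem_rV_M //; apply: mem_quotient.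
have v_onto u : exists2 x, x \in P & v x = u.
  have /morphimP[y Ny Py Dx] : rVabelem abE ntE u \in E by apply: mem_rVabelem.
  exists y => //.
  by rewrite /v -[RHS](rVabelemK abE ntE) Dx.
have [a Pa va] := v_onto (delta_mx 0 ord0).
have [b Pb vb] := v_onto (delta_mx 0 (Ordinal dimE)).
have phi1 : phi 1 = 1.
  by rewrite /phi /= modp.
exists (fun x => phi (v x 0 ord0)), (fun x => phi (v x 0 (Ordinal dimE))), a, b.
rewrite va vb !mxE; split; rewrite ?Pa ?Pb //.
- by move=> x y Px Py; rewrite vM // mxE phiD.
- by move=> x y Px Py; rewrite vM // mxE phiD.
Qed.

Section Pencil.

Definition pencil (R : nzRingType) m (Y X : 'M[R]_m) (c : R) := Y - c *: X.

Lemma exists_minor (F : fieldType) m (A : 'M[F]_m) :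
  exists f g : 'I_(\rank A) -> 'I_m, \det (mxsub f g A) != 0.
Proof.
set B := (rowsub (maxrankfun A) A)^T.
have rB : \rank B = \rank A by rewrite mxrank_tr eq_maxrowsub.
have cast s r q (e : s = r) (h : 'I_s -> 'I_m) (C : 'M[F]_(m, q)) :
    row_free (rowsub h C) -> exists g : 'I_r -> 'I_m, row_free (rowsub g C).
  by case: r / e => freeh; exists h.
have [g freeg] := cast _ _ _ rB _ _ (maxrowsub_free B).
exists (maxrankfun A), g; rewrite -unitfE -unitmxE -unitmx_tr -row_free_unit.
suff -> : (mxsub (maxrankfun A) g A)^T = rowsub g B by [].
by apply/matrixP=> x y; rewrite !mxE.
Qed.

Lemma rank_mxsub (F : fieldType) m n s r (f : 'I_s -> 'I_m) (g : 'I_r -> 'I_n)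
    (A : 'M[F]_(m, n)) : (\rank (mxsub f g A) <= \rank A)%N.
Proof.
have -> : mxsub f g A = rowsub f (colsub g A) by apply/matrixP=> x y; rewrite !mxE.
apply: leq_trans (mxrankS (rowsub_sub f (colsub g A))) _.
rewrite -mxrank_tr -(mxrank_tr A); have -> : (colsub g A)^T = rowsub g A^T.
  by apply/matrixP=> x y; rewrite !mxE.
exact/mxrankS/rowsub_sub.
Qed.

(** A minor of Y - c X, as a polynomial in c. *)
Definition pencil_minor (F : fieldType) m s (f g : 'I_s -> 'I_m)
    (Y X : 'M[F]_m) : {poly F} :=
  \det (mxsub f g (pencil (map_mx polyC Y) (map_mx polyC X) 'X)).

Lemma pencil_minorE (F K : fieldType) (j : {rmorphism F -> K}) m s
    (f g : 'I_s -> 'I_m) (Y X : 'M[F]_m) c :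
  (map_poly j (pencil_minor f g Y X)).[c] =
  \det (mxsub f g (pencil (map_mx j Y) (map_mx j X) c)).
Proof.
rewrite -horner_evalE -!det_map_mx; congr (\det _).
apply/matrixP=> x y; rewrite !mxE !rmorphB !rmorphM /= !map_polyC map_polyX /=.
by rewrite !horner_evalE !hornerC hornerX.
Qed.

(** The polynomial h is a minor of maximal size that does not vanish at t. *)
Lemma pencil_rank_generic (K : fieldType) m (Y X : 'M[K]_m) (t : K) :
  exists2 h : {poly K}, h != 0 &
    forall c, h.[c] != 0 -> (\rank (pencil Y X t) <= \rank (pencil Y X c))%N.
Proof.
have [f [g nz]] := exists_minor (pencil Y X t).
have hE c : (pencil_minor f g Y X).[c] = \det (mxsub f g (pencil Y X c)).
  have := pencil_minorE idfun f g Y X c; rewrite map_poly_id // !map_mx_id //.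
exists (pencil_minor f g Y X) => [|c].
  by apply: contraNneq nz => h0; rewrite -hE h0 horner0.
rewrite hE -unitfE -unitmxE => u; apply: leq_trans (rank_mxsub f g _).
exact: eq_leq (esym (mxrank_unit u)).
Qed.

(** A nonzero minor at c is a nonzero polynomial over K0; it vanishes at t if
    its size exceeds the rank there. *)
Lemma rank_drop_algebraic (K0 K : fieldType) (j : {rmorphism K0 -> K}) m
    (Y X : 'M[K0]_m) (c t : K) :
    (\rank (pencil (map_mx j Y) (map_mx j X) t) <
     \rank (pencil (map_mx j Y) (map_mx j X) c))%N ->
  algebraicOver j t.
Proof.
move=> lt_tc; have [f [g nz]] := exists_minor (pencil (map_mx j Y) (map_mx j X) c).
exists (pencil_minor f g Y X).
  by apply: contraNneq nz => h0; rewrite -pencil_minorE h0 rmorph0 horner0.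
rewrite rootE pencil_minorE; apply: contraLR lt_tc.
rewrite -unitfE -unitmxE => u; rewrite -leqNgt.
by apply: leq_trans (rank_mxsub f g _); apply: eq_leq (esym (mxrank_unit u)).
Qed.

Section PencilOfRepr.

Variables (K : fieldType) (gT : finGroupType) (G : {group gT}) (a b : gT).
Hypotheses (Ga : a \in G) (Gb : b \in G).

Definition repr_pencil n (r : mx_representation K G n) :=
  pencil (r b - 1%:M) (r a - 1%:M).

Lemma rank_repr_pencil_rsim n1 n2 (r1 : mx_representation K G n1)
    (r2 : mx_representation K G n2) c :
  mx_rsim r1 r2 -> \rank (repr_pencil r1 c) = \rank (repr_pencil r2 c).
Proof.
case/rsim_mutual_inverse=> A [B [AB BA rA rB]].
have le m1 m2 (s1 : mx_representation K G m1) (s2 : mx_representation K G m2) C D :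
    C *m D = 1%:M -> intertwines s1 s2 C ->
    (\rank (repr_pencil s1 c) <= \rank (repr_pencil s2 c))%N.
  move=> CD sC; have E : repr_pencil s1 c *m C = C *m repr_pencil s2 c.
    rewrite /repr_pencil /pencil !mulmxBl !mulmxBr -scalemxAl -scalemxAr.
    by rewrite !mulmxBl !mulmxBr !mul1mx !mulmx1 !sC.
  rewrite -[repr_pencil s1 c]mulmx1 -CD mulmxA E.
  by apply: leq_trans (mxrankM_maxl _ _) (mxrankM_maxr _ _).
by apply/eqP; rewrite eqn_leq (le _ _ _ _ _ _ AB rA) (le _ _ _ _ _ _ BA rB).
Qed.

Lemma rank_repr_pencil_dadd (r1 r2 : representation K G) c :
  \rank (repr_pencil (dadd_grepr r1 r2) c) =
  (\rank (repr_pencil r1 c) + \rank (repr_pencil r2 c))%N.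
Proof.
rewrite -rank_diag_block_mx; congr (\rank _).
rewrite /repr_pencil /pencil /= scalar_mx_block opp_block_mx !add_block_mx.
by rewrite scale_block_mx opp_block_mx add_block_mx !(oppr0, addr0, scaler0).
Qed.

End PencilOfRepr.

End Pencil.

Section ShearModule.

Variables (K : fieldType) (gT : finGroupType) (P : {group gT}).
Variables (al be : gT -> K) (n : nat) (t : 'I_n -> K).
Hypothesis alM : {in P &, {morph al : x y / (x * y)%g >-> x + y}}.
Hypothesis beM : {in P &, {morph be : x y / (x * y)%g >-> x + y}}.

(** The sum of n modules of dimension 2: the i-th one sends x to the unipotent
    matrix with upper right entry al x + be x t_i. *)
Definition shear_mx (x : gT) : 'M[K]_(n + n) :=
  block_mx 1%:M ((al x)%:M + be x *: diag_mx (\row_i t i)) 0 1%:M.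

Lemma shear_mx_repr : mx_repr P shear_mx.
Proof.
have P1 := group1 P.
have al1 : al 1%g = 0 by apply: (addrI (al 1%g)); rewrite -alM // mulg1 addr0.
have be1 : be 1%g = 0 by apply: (addrI (be 1%g)); rewrite -beM // mulg1 addr0.
split=> [|x y Px Py].
  by rewrite /shear_mx al1 be1 scale0r addr0 scalar_mx_block raddf0.
rewrite /shear_mx mulmx_block !(mulmx0, mul0mx, mulmx1, mul1mx, addr0, add0r).
by rewrite alM // beM // raddfD scalerDl addrACA addrC.
Qed.

Definition shear_repr := MxRepresentation shear_mx_repr.

Lemma shear_pencil a b c : al a = 1 -> al b = 0 -> be a = 0 -> be b = 1 ->
  repr_pencil a b shear_repr c =
  block_mx 0 (diag_mx (\row_i (t i - c))) 0 0.
Proof.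
move=> ala alb bea beb; rewrite /repr_pencil /pencil /= /shear_mx ala alb bea beb.
rewrite !scalar_mx_block !opp_block_mx !add_block_mx scale_block_mx.
rewrite opp_block_mx add_block_mx !(subrr, oppr0, addr0, scaler0, raddf0, add0r).
rewrite scale0r scale1r addr0; congr (block_mx _ _ _ _).
apply/matrixP=> x y; rewrite !mxE; case: eqP => _.
  by rewrite ?mulr1n ?mulr1.
by rewrite ?mulr0n ?mulr0 ?subrr.
Qed.

Lemma rank_shear_pencil a b c : al a = 1 -> al b = 0 -> be a = 0 -> be b = 1 ->
  (\rank (repr_pencil a b shear_repr c) == n) = [forall i, t i != c].
Proof.
move=> ala alb bea beb; rewrite shear_pencil // block_mxEv row_mx0 rank_col_mx0.
rewrite rank_row_0mx -/(row_free _) row_free_unit unitmxE unitfE det_diag.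
apply/prodf_neq0/forallP => nz i; first by have := nz i isT; rewrite mxE subr_eq0.
by move=> _; rewrite mxE subr_eq0.
Qed.

End ShearModule.

(** The shear module V is a summand of the restriction of the induced module.
    The rank of the pencil of a complement is generically at least its value
    at t_i, whereas the pencil of V has rank n generically and less at t_i. *)
Lemma shear_parameter_algebraic (K0 K : fieldType) (j : {rmorphism K0 -> K})
    (gT : finGroupType) (G P : {group gT}) (sPG : P \subset G)
    (al be : gT -> K) (a b : gT) n (t : 'I_n -> K)
    (alM : {in P &, {morph al : x y / (x * y)%g >-> x + y}})
    (beM : {in P &, {morph be : x y / (x * y)%g >-> x + y}}) :
    a \in P -> b \in P -> al a = 1 -> al b = 0 -> be a = 0 -> be b = 1 ->
    (forall h : {poly K}, h != 0 -> exists c, h.[c] != 0) ->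
    defined_over j (induced_repr sPG (shear_repr t alM beM)) ->
  forall i, algebraicOver j (t i).
Proof.
move=> Pa Pb ala alb bea beb infK [m [r0 sim]] i.
set V := shear_repr t alM beM in sim.
have Ga := subsetP sPG a Pa; have Gb := subsetP sPG b Pb.
have [rC simC] := summand_complement (summand_restrict_induced sPG V).
have rk c : \rank (pencil (map_mx j (r0 b - 1%:M)) (map_mx j (r0 a - 1%:M)) c) =
    (\rank (repr_pencil a b V c) + \rank (repr_pencil a b rC c))%N.
  rewrite -(rank_repr_pencil_dadd a b (Representation V) rC).
  rewrite -(rank_repr_pencil_rsim Pa Pb c simC).
  rewrite [RHS](rank_repr_pencil_rsim Ga Gb c sim).
  by rewrite !map_mxB !map_mx1.
have [h h0 hP] := pencil_rank_generic (rC b - 1%:M) (rC a - 1%:M) (t i).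
have [|c] := infK (h * \prod_i ('X - (t i)%:P)).
  by rewrite mulf_neq0 //; apply/prodf_neq0=> l _; rewrite polyXsubC_eq0.
rewrite hornerM mulf_eq0 negb_or horner_prod => /andP[hc /prodf_neq0 ct].
apply: (@rank_drop_algebraic _ _ j _ (r0 b - 1%:M) (r0 a - 1%:M) c).
rewrite !rk -addSn leq_add ?hP //.
have rkV := rank_shear_pencil t alM beM _ ala alb bea beb.
have /eqP -> : \rank (repr_pencil a b V c) == n.
  rewrite rkV; apply/forallP=> l; have := ct l isT.
  by rewrite hornerXsubC subr_eq0 eq_sym.
have := rank_leq_col (diag_mx (\row_l (t l - t i))).
rewrite ltn_neqAle rkV /V (shear_pencil t alM beM) //.
rewrite block_mxEv row_mx0 rank_col_mx0 rank_row_0mx => ->; rewrite andbT.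
by apply/negP=> /forallP/(_ i); rewrite eqxx.
Qed.

(** The powers of a variable are infinitely many candidates for c. *)
Lemma frac_infinite (F : fieldType) n (i : 'I_n) (h : {poly {fraction mpoly n F}}) :
  h != 0 -> exists c, h.[c] != 0.
Proof.
move=> h0; apply: contrapT => no.
pose s := [seq frac_var F i ^+ k | k <- iota 0 (size h)].
have us : uniq s.
  rewrite map_inj_in_uniq ?iota_uniq // => k l _ _ /eqP.
  rewrite /frac_var -!rmorphXn -subr_eq0 -rmorphB frac_eq0 subr_eq0 => /eqP.
  rewrite !mpolyXn => /(congr1 (@mlead n F)); rewrite !mleadXm => /mnmP/(_ i).
  by rewrite !mulmnE mnm1E eqxx !mul1n.
have : (size s < size h)%N.
  apply: max_poly_roots => //; apply/allP=> c _; rewrite rootE.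
  by apply/negPn/negP=> hc; apply: no; exists c.
by rewrite size_map size_iota ltnn.
Qed.

Lemma ed_Mod_noncyclic (R : realType) p (F : fieldType) (gT : finGroupType)
    (G P : {group gT}) n :
    p \in [pchar F] -> p.-Sylow(G)%g P -> ~~ cyclic P ->
  (n%:R%:E <= ed_Mod R F G)%E.
Proof.
move=> pF sylP ncP; pose K := {fraction mpoly n F}.
have [->|n_gt0] := posnP n.
  apply: le_trans (ed_Mod_ge R (idfun : {rmorphism F -> F}) (@grepr0 F gT G)).
  exact: ed_ge0.
have pK : p \in [pchar K] by rewrite (fmorph_pchar (frac_const F n)).
have [al [be [a [b [alM beM /andP[Pa Pb] [ala alb] [bea beb]]]]]] :=
  noncyclic_coordinates pK (pHall_pgroup sylP) ncP.
have sPG := pHall_sub sylP.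
pose M := induced_repr sPG (shear_repr (@frac_var F n) alM beM).
apply: le_trans (ed_Mod_ge R (frac_const F n) M).
apply: le_ereal_inf_tmp => _ [K0 [i [j [[ij defM] ->]]]].
apply: ereal_sup_ubound; exists n => //.
apply: (algebraic_vars_independent ij).
apply: (shear_parameter_algebraic Pa Pb ala alb bea beb _ defM).
exact: (frac_infinite (Ordinal n_gt0)).
Qed.

Theorem theorem1p4 (R : realType) (p : nat) (gT : finGroupType)
    (G : {group gT}) (F : fieldType)
    (p_pr : prime p) (charF : p \in [pchar F]%R) :
  ((forall P : {group gT}, p.-Sylow(G)%g P -> cyclic P) <->
     ed_Mod R F G = 0%E) /\
  (ed_Mod R F G = 0%E <-> (ed_Mod R F G < +oo)%E).
Proof.
have ed_cyclic := @ed_Mod_cyclic R p F gT G charF.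
have cyclic_ed : (ed_Mod R F G < +oo)%E ->
    forall P : {group gT}, p.-Sylow(G)%g P -> cyclic P.
  move=> edfin P sylP; have [// | ncP] := boolP (cyclic P).
  have ed_ge n := ed_Mod_noncyclic R n charF sylP ncP.
  have := ed_ge 0%N; case: (ed_Mod R F G) edfin ed_ge => // r _ ed_ge.
  rewrite lee_fin => r0; have := ed_ge (Num.bound r); rewrite lee_fin leNgt.
  by rewrite archi_boundP.
have ed0_fin : ed_Mod R F G = 0%E -> (ed_Mod R F G < +oo)%E by move=> ->; rewrite ltry.
split; split=> //.
- by move/ed0_fin/cyclic_ed.
- by move/cyclic_ed/ed_cyclic.
Qed.
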